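(* Let $G$ be a connected unicyclic graph with odd girth $g$, and let $h$ be the maximum diameter among the induced trees of $G$ (the trees rooted at the vertices of the cycle of $G$). Let $\lambda_1(G)$ and $\lambda_n(G)$ be the largest and the smallest eigenvalue of $G$, respectively. If $$\lambda_n(G)\geq 1-\cos\frac{\pi}{D_0+1}-\lambda_1(G),\qquad\text{where } D_0=\frac{g+1}{2}+h,$$ then $$S(G)\leq S_{\mathcal{L}}(G).$$
   Context: Graphs are finite, simple and undirected. A connected unicyclic graph is a connected graph with exactly one cycle; its girth $g$ is the length of that cycle. The induced trees of such a $G$ are the trees rooted at the cycle vertices: for each vertex $v$ of the cycle $C$, the tree rooted at $v$ is the connected component containing $v$ of the graph obtained from $G$ by deleting all edges of $C$ (so $v$ itself belongs to the tree). The diameter of a connected graph is the maximum distance between two of its vertices. The eigenvalues of $G$ are those of its adjacency matrix; $S(G)=\lambda_1(G)-\lambda_n(G)$ where $n$ is the number of vertices. The line graph $\mathcal{L}(G)$ has the edges of $G$ as vertices, two being adjacent if the corresponding edges of $G$ share a common vertex. $S_{\mathcal{L}}(G)$ is the largest minus the smallest adjacency eigenvalue of $\mathcal{L}(G)$. *)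

(* Defs.v *)
From mathcomp Require Import all_boot all_order all_algebra.
From mathcomp Require Import all_classical all_reals all_analysis.

Set Implicit Arguments.
Unset Strict Implicit.
Unset Printing Implicit Defensive.

Import Order.TTheory GRing.Theory Num.Theory.

Local Open Scope nat_scope.

Record sgraph := SGraph {
  vertex :> finType;
  adj : rel vertex;
  adj_sym : symmetric adj;
  adj_irr : irreflexive adj }.

Definition connected_graph (G : sgraph) : Prop := forall x y : G, connect (@adj G) x y.

Definition edges (G : sgraph) : {set {set G}} :=
  [set [set p.1; p.2] | p : G * G & adj p.1 p.2].

(* A cycle is identified with its edge set, so that the rotations and
   reflections of a vertex sequence count as one cycle. *)
Definition cycle_edges (G : sgraph) (c : seq G) : {set {set G}} :=
  [set [set x; next c x] | x in c].

Definition is_cycle (G : sgraph) (C : {set {set G}}) : Prop :=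
  exists c : seq G, [/\ ucycle (@adj G) c, 2 < size c & C = cycle_edges c].

Definition connected_unicyclic (G : sgraph) : Prop :=
  connected_graph G /\ exists! C : {set {set G}}, is_cycle C.

Section Subgraphs.
Variable G : sgraph.

Definition del_adj (F : {set {set G}}) : rel G :=
  fun x y => adj x y && ([set x; y] \notin F).

Lemma del_adj_sym F : symmetric (del_adj F).
Proof. by move=> x y; rewrite /del_adj adj_sym finset.setUC. Qed.

Lemma del_adj_irr F : irreflexive (del_adj F).
Proof. by move=> x; rewrite /del_adj adj_irr. Qed.

Definition del_edges (F : {set {set G}}) : sgraph :=
  SGraph (@del_adj_sym F) (@del_adj_irr F).

Definition induced_adj (A : {set G}) : rel {x : G | x \in A} :=
  fun x y => adj (val x) (val y).

Lemma induced_adj_sym A : symmetric (@induced_adj A).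
Proof. by move=> x y; apply: adj_sym. Qed.

Lemma induced_adj_irr A : irreflexive (@induced_adj A).
Proof. by move=> x; apply: adj_irr. Qed.

Definition induced_subgraph (A : {set G}) : sgraph :=
  SGraph (@induced_adj_sym A) (@induced_adj_irr A).

Definition component (v : G) : sgraph :=
  induced_subgraph [set w : G | connect (@adj G) v w].

Definition line_adj : rel {e : {set G} | e \in edges G} :=
  fun e f => (e != f) && (val e :&: val f != finset.set0).

Lemma line_adj_sym : symmetric line_adj.
Proof. by move=> e f; rewrite /line_adj eq_sym finset.setIC. Qed.

Lemma line_adj_irr : irreflexive line_adj.
Proof. by move=> e; rewrite /line_adj eqxx. Qed.

Definition line_graph : sgraph := SGraph line_adj_sym line_adj_irr.

End Subgraphs.

Definition rooted_tree (G : sgraph) (C : {set {set G}}) (v : G) : sgraph :=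
  component (v : del_edges C).

(* Least length of a walk from x to y; the junk value #|G|, which exceeds
   every distance, is returned when there is none. *)
Definition graph_dist (G : sgraph) (x y : G) : nat :=
  \big[minn/#|G|]_(k < #|G|
     | [exists p : k.-tuple G, path (@adj G) x p && (last x p == y)]) k.

Definition diameter (G : sgraph) : nat := \max_(x : G) \max_(y : G) graph_dist x y.

(* The vertex set of the cycle C is cover C, the union of its edges. *)
Definition max_tree_diameter (G : sgraph) (C : {set {set G}}) : nat :=
  \max_(v in finset.cover C) diameter (rooted_tree C v).

Local Open Scope ring_scope.

Definition adj_mx (R : realType) (G : sgraph) : 'M[R]_#|G| :=
  \matrix_(i, j) (adj (enum_val i) (enum_val j))%:R.

(* The spectrum of a symmetric real matrix of positive size is finite and
   nonempty, so the supremum and infimum below are attained. *)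
Definition lambda_max (R : realType) (G : sgraph) : R :=
  sup [set a : R | eigenvalue (adj_mx R G) a]%classic.

Definition lambda_min (R : realType) (G : sgraph) : R :=
  inf [set a : R | eigenvalue (adj_mx R G) a]%classic.

Definition spread (R : realType) (G : sgraph) : R :=
  lambda_max R G - lambda_min R G.

(* Main.v *)
Require Import Defs.
From mathcomp Require Import all_boot all_order all_algebra.
From mathcomp Require Import all_classical all_reals all_analysis.
From mathcomp Require Import ring lra zify.

(** Let [B] be the vertex-edge incidence matrix of [G], [A] its adjacency matrix
    and [D] the diagonal matrix of its degrees. Then [B B^T = D + A] and [B^T B = 2 + A'],
    where [A'] is the adjacency matrix of the line graph. Write [l] for the largest
    eigenvalue of [G], and [rho] and [sigma] for the extreme eigenvalues of the line
    graph, increased by 2. As the hypothesis bounds the sum of the extreme eigenvalues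
    of [G] below by [delta = 1 - cos (pi / (D0 + 1))], it suffices to show
<<
      sigma <= (rho - 2 l) + delta.
>>
    The form of [D + A] at [y] is the sum of [(y u + y v) ^ 2] over the edges [uv].
    Its Rayleigh quotients are at most [rho] ([qform_max]), and at least [sigma]
    ([qform_min]); the second fact needs the odd cycle, which makes [D + A]
    nonsingular. If [G] is a cycle, then [D + A = 2 + A] and the claim is immediate.
    Otherwise both sides of the inequality are estimated separately.

    The gap [rho - 2 l] vanishes for regular graphs, and a unicyclic graph that is
    not a cycle is far from regular. As [G] has as many edges as vertices, it can be
    oriented with exactly one edge leaving each vertex: along the cycle, or towards
    it. For an eigenvector [x] of [l], the test vector [B^T x] then reduces
    [rho - 2 l >= gam] to an inequality at each vertex between [x] at that vertex, at
    its out-neighbour and at its in-neighbours ([gap_certificate]). It holds as soon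
    as [l] exceeds 2 by a definite amount. For smaller [l] the gap comes from
    [rho] itself: an explicit vector around a cycle vertex [w] with a tree shows that
    [rho] is well above 4 ([rho_test]).

    For [sigma], let [w] be the root of an induced tree of diameter [h]. This tree
    has at least [h] vertices besides [w]. The test vector alternates in sign along
    all edges; its absolute value is constant on these vertices, and decreases from
    [w] along the cycle to the point opposite to [w], where the alternation
    breaks ([sigma_test]). Its Rayleigh quotient is at
    most [gam + delta], because [delta >= 4.8 / K ^ 2 - 3.84 / K ^ 4] for
    [K = D0 + 1] ([cos_pi_div_le]).

    The admissible [gam] depends on the girth: girth at least 7, girth 5, and girth 3
    according to whether [w] has one or several neighbours off the cycle
    ([long_cycle_bound], [pentagon_bound], [triangle_path], [triangle_broom]). A
    triangle with [h = 1] escapes these estimates; there each cycle vertex carries at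
    most one leaf, and the eigenvector equations on the triangle bound [l]
    ([triangle_leaves]). *)

Set Implicit Arguments.
Unset Strict Implicit.
Unset Printing Implicit Defensive.

Import Order.TTheory GRing.Theory Num.Theory.

Local Open Scope ring_scope.

(** * Extreme eigenvalues as extremal values of quadratic forms *)

Section QuadraticForms.
Variables (R : realType) (n : nat).
Implicit Types (A B C : 'M[R]_n) (u v : 'rV[R]_n).

Definition bform A u v : R := (u *m A *m v^T) 0 0.
Definition sqn u : R := \sum_i u 0 i ^+ 2.

Lemma bformE A u v : bform A u v = \sum_i \sum_j A i j * u 0 i * v 0 j.
Proof.
rewrite /bform mxE exchange_big /=; apply: eq_bigr => j _.
rewrite !mxE big_distrl /=; apply: eq_bigr => i _.
by rewrite mulrC [A i j * _]mulrC mulrC.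
Qed.

Lemma bform1 u : bform 1%:M u u = sqn u.
Proof. by rewrite /bform mulmx1 mxE; apply: eq_bigr => i _; rewrite mxE expr2. Qed.

Lemma sqn_ge0 u : 0 <= sqn u.
Proof. by apply: sumr_ge0 => i _; apply: sqr_ge0. Qed.

Lemma sqn_eq0 u : sqn u = 0 -> u = 0.
Proof.
move=> /eqP; rewrite psumr_eq0 => [/allP h|i _]; last exact: sqr_ge0.
apply/rowP => i; rewrite mxE; apply/eqP.
by rewrite -sqrf_eq0; apply: h; rewrite mem_index_enum.
Qed.

Lemma bform_bound A u : bform A u u <= (\sum_i \sum_j `|A i j|) * sqn u.
Proof.
rewrite bformE big_distrl /=; apply: ler_sum => i _.
rewrite big_distrl /=; apply: ler_sum => j _.
have le1 k : u 0 k ^+ 2 <= sqn u.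
  by rewrite /sqn (bigD1 k) //= lerDl sumr_ge0 // => l _; apply: sqr_ge0.
apply: le_trans (ler_norm _) _; rewrite -mulrA normrM ler_wpM2l ?normr_ge0 //.
rewrite ler_norml; have := le1 i; have := le1 j.
have := sqr_ge0 (u 0 i - u 0 j); have := sqr_ge0 (u 0 i + u 0 j).
by move: (u 0 i) (u 0 j) (sqn u) => a b s *; apply/andP; split; nra.
Qed.

Lemma bformBl A B u v : bform (A - B) u v = bform A u v - bform B u v.
Proof. by rewrite /bform mulmxBr mulmxBl !mxE. Qed.

Lemma bform_scalar a u : bform a%:M u u = a * sqn u.
Proof. by rewrite -bform1 /bform mulmx1 mul_mx_scalar -scalemxAl mxE. Qed.

(** With [M] a bound for the form of [B^-1], the nonnegativity of the form of [B]
    at [M u - u B^-1] is exactly the claim for [e = 1 / M]. *)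
Lemma posdef_bound B : B^T = B -> B \in unitmx ->
  (forall u, 0 <= bform B u u) -> exists2 e, 0 < e & forall u, e * sqn u <= bform B u u.
Proof.
move=> symB unB psd.
pose M := 1 + \sum_i \sum_j `|invmx B i j|.
have M1 : 1 <= M by rewrite lerDl sumr_ge0 // => i _; rewrite sumr_ge0.
have M0 : 0 < M by apply: lt_le_trans M1.
exists M^-1 => [|u]; first by rewrite invr_gt0.
pose v := u *m invmx B.
have vB : v *m B = u by rewrite /v mulmxKV.
have h1 : bform B v v <= M * sqn u.
  have -> : bform B v v = bform (invmx B) u u.
    have symC : (invmx B)^T = invmx B by rewrite trmx_inv symB.
    by rewrite /bform vB /v trmx_mul symC mulmxA.
  by apply: le_trans (bform_bound _ _) _; rewrite ler_wpM2r ?sqn_ge0 // lerDr.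
have h2 : bform B u v = sqn u.
  have uT : u^T = B *m v^T by rewrite -{1}vB trmx_mul symB.
  by rewrite -bform1 /bform mulmx1 -mulmxA -uT.
have h3 : bform B v u = sqn u by rewrite /bform vB -bform1 /bform mulmx1.
have h4 := psd (M *: u - v).
have e4 : bform B (M *: u - v) (M *: u - v)
   = M ^+ 2 * bform B u u - 2 * M * sqn u + bform B v v.
  have bZl (r : R) (s t : 'rV[R]_n) : bform B (r *: s) t = r * bform B s t.
    by rewrite /bform -!scalemxAl mxE.
  have bZr (r : R) (s t : 'rV[R]_n) : bform B s (r *: t) = r * bform B s t.
    by rewrite /bform linearZ /= -!scalemxAr mxE.
  have bBl (r s t : 'rV[R]_n) : bform B (r - s) t = bform B r t - bform B s t.
    by rewrite /bform !mulmxBl !mxE.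
  have bBr (r s t : 'rV[R]_n) : bform B t (r - s) = bform B t r - bform B t s.
    by rewrite /bform linearB /= mulmxBr !mxE.
  by rewrite bBl !bBr !bZl !bZr h2 h3; ring.
rewrite e4 in h4.
rewrite mulrC ler_pdivrMr //.
have : M * sqn u <= M * (M * bform B u u) by lra.
by rewrite ler_pM2l // mulrC.
Qed.

(** The least [a] with [bform A v v <= a * sqn v] for all [v] is an eigenvalue:
    otherwise [a - A] is invertible, and [posdef_bound] allows a smaller [a]. *)
Lemma sym_form_max A : (0 < n)%N -> A^T = A ->
  exists a u, [/\ u != 0, u *m A = a *: u & forall v, bform A v v <= a * sqn v].
Proof.
move=> n0 symA.
pose E := [set t : R | forall u, bform A u u <= t * sqn u]%classic.
pose i0 := Ordinal n0.
have EneT : (E !=set0)%classic.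
  by exists (\sum_i \sum_j `|A i j|) => u; apply: bform_bound.
have Elb : has_lbound E.
  exists (bform A (delta_mx 0 i0) (delta_mx 0 i0)) => t /(_ (delta_mx 0 i0)).
  suff -> : sqn (delta_mx 0 i0) = 1 by rewrite mulr1.
  rewrite /sqn (bigD1 i0) //= mxE !eqxx expr1n big1 ?addr0 // => j /negbTE ji.
  by rewrite mxE ji andbF expr0n.
have hinf : has_inf E by split.
set a := inf E.
have aE : forall v, bform A v v <= a * sqn v.
  move=> v; have [/sqn_eq0 ->|v0] := eqVneq (sqn v) 0.
    by rewrite bformE /sqn !big1 ?mulr0 // => i _; rewrite ?big1 // => *; rewrite !mxE ?expr0n ?mulr0 ?mul0r.
  have vp : 0 < sqn v by rewrite lt_neqAle eq_sym v0 sqn_ge0.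
  rewrite -ler_pdivrMr //; apply: lb_le_inf => // t /(_ v).
  by rewrite ler_pdivrMr.
pose B := a%:M - A.
have symB : B^T = B by rewrite /B linearB /= tr_scalar_mx symA.
have psd u : 0 <= bform B u u by rewrite bformBl bform_scalar subr_ge0.
have sing : B \notin unitmx.
  apply/negP => unB; have [e e0 he] := posdef_bound symB unB psd.
  have : E (a - e).
    by move=> u; have := he u; rewrite bformBl bform_scalar; lra.
  move=> /(ge_inf Elb); rewrite -/a; lra.
have : ~~ row_free B by rewrite row_free_unit.
rewrite -kermx_eq0 => /rowV0Pn[u /sub_kermxP uB u0].
exists a, u; split => //.
by move/eqP: uB; rewrite /B mulmxBr mul_mx_scalar subr_eq0 => /eqP.
Qed.

End QuadraticForms.

Section Kernels.
Variables (R : realType) (T : finType).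

Lemma sum_enum_val (F : T -> R) : \sum_t F t = \sum_(i < #|T|) F (enum_val i).
Proof. by rewrite big_enum_val. Qed.

(** The form of [sym_form_max] on functions on any finite type, so that the same
    result serves [G], its line graph and the signless Laplacian without enumerating
    their vertices. *)
Lemma sym_kernel_max (K : T -> T -> R) (t0 : T) : (forall s t, K s t = K t s) ->
  exists a x, [/\ exists t, x t != 0,
    forall s, \sum_t K s t * x t = a * x s &
    forall y, \sum_s \sum_t K s t * y s * y t <= a * \sum_t y t ^+ 2].
Proof.
move=> symK.
pose A : 'M[R]_#|T| := \matrix_(i, j) K (enum_val i) (enum_val j).
have n0 : (0 < #|T|)%N by apply/card_gt0P; exists t0.
have symA : A^T = A by apply/matrixP => i j; rewrite !mxE.
have [a [u [u0 uA uform]]] := sym_form_max n0 symA.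
exists a, (fun t => u 0 (enum_rank t)); split.
- have [i ui] : exists i, u 0 i != 0.
    apply/existsP; move: u0; apply: contraR => /existsPn h.
    by apply/eqP/rowP => i; rewrite mxE; apply/eqP; have := h i; rewrite negbK.
  by exists (enum_val i); rewrite enum_valK.
- move=> s; have /rowP/(_ (enum_rank s)) := uA; rewrite !mxE => <-.
  rewrite sum_enum_val; apply: eq_bigr => i _.
  by rewrite mxE enum_rankK enum_valK mulrC symK.
- move=> y; have := uform (\row_i y (enum_val i)); rewrite bformE /sqn.
  rewrite [\sum_t y t ^+ 2]sum_enum_val sum_enum_val.
  under eq_bigr => i _ do under eq_bigr => j _ do rewrite !mxE.
  under [X in _ <= a * X]eq_bigr => i _ do rewrite !mxE.
  by under [X in _ -> X <= _]eq_bigr => i _ do rewrite sum_enum_val.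
Qed.

End Kernels.

Section Extremal.
Variables (R : realType) (G : sgraph) (g0 : G).

Definition nbr_sum (x : G -> R) (v : G) : R := \sum_(u | adj v u) x u.

Lemma nbr_sumE x v : nbr_sum x v = \sum_u (adj v u)%:R * x u.
Proof.
rewrite /nbr_sum big_mkcond; apply: eq_bigr => u _.
by case: ifP; rewrite ?mul1r ?mul0r.
Qed.

Lemma eigenvalue_nbr_sum (a : R) (x : G -> R) (v : G) : x v != 0 ->
  (forall u, nbr_sum x u = a * x u) -> eigenvalue (adj_mx R G) a.
Proof.
move=> xv hx; apply/eigenvalueP; exists (\row_i x (enum_val i)).
  apply/rowP => j; rewrite !mxE -hx nbr_sumE [RHS]sum_enum_val; apply: eq_bigr => i _.
  by rewrite !mxE mulrC adj_sym.
apply/eqP => /rowP/(_ (enum_rank v)); rewrite !mxE enum_rankK => /eqP.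
by rewrite (negbTE xv).
Qed.

Lemma nbr_sum_eigenvalue (a : R) : eigenvalue (adj_mx R G) a ->
  exists x v, x v != 0 /\ forall u, nbr_sum x u = a * x u.
Proof.
move=> /eigenvalueP[r rA r0].
exists (fun v => r 0 (enum_rank v)).
have [i ri] : exists i, r 0 i != 0.
  apply/existsP; move: r0; apply: contraR => /existsPn h.
  by apply/eqP/rowP => i; rewrite mxE; apply/eqP; have := h i; rewrite negbK.
exists (enum_val i); rewrite enum_valK; split=> // u.
have /rowP/(_ (enum_rank u)) := rA; rewrite !mxE => <-.
rewrite nbr_sumE [LHS]sum_enum_val; apply: eq_bigr => j _.
by rewrite mxE enum_rankK enum_valK mulrC adj_sym.
Qed.

Lemma nbr_sum_form x : \sum_s \sum_t (adj s t)%:R * x s * x t = \sum_v x v * nbr_sum x v :> R.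
Proof.
by apply: eq_bigr => v _; rewrite nbr_sumE big_distrr /=; apply: eq_bigr => u _; ring.
Qed.

Lemma sum_sqr_gt0 (x : G -> R) v : x v != 0 -> 0 < \sum_u x u ^+ 2.
Proof.
move=> xv; rewrite (bigD1 v) //= ltr_pwDl //; last by apply: sumr_ge0 => *; apply: sqr_ge0.
by rewrite lt_neqAle eq_sym sqrf_eq0 xv sqr_ge0.
Qed.

Lemma form_eigen (a : R) x : (forall u, nbr_sum x u = a * x u) ->
  \sum_v x v * nbr_sum x v = a * \sum_v x v ^+ 2.
Proof. by move=> hx; rewrite big_distrr /=; apply: eq_bigr => v _; rewrite hx; ring. Qed.

Lemma lambda_maxP : exists x v, [/\ x v != 0,
   forall u, nbr_sum x u = lambda_max R G * x u &
   forall y, \sum_v y v * nbr_sum y v <= lambda_max R G * \sum_v y v ^+ 2].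
Proof.
have [|a [x [[v xv] hx hform]]] := @sym_kernel_max R G (fun s t => (adj s t)%:R) g0.
  by move=> s t; rewrite adj_sym.
have hx' u : nbr_sum x u = a * x u by rewrite nbr_sumE hx.
have hform' y : \sum_v y v * nbr_sum y v <= a * \sum_v y v ^+ 2.
  by rewrite -nbr_sum_form.
suff -> : lambda_max R G = a by exists x, v.
have ub : ubound [set b : R | eigenvalue (adj_mx R G) b]%classic a.
  move=> b /nbr_sum_eigenvalue[y [w [yw hy]]].
  have := hform' y; rewrite (form_eigen hy) ler_pM2r //; exact: sum_sqr_gt0 yw.
have ea : [set b : R | eigenvalue (adj_mx R G) b]%classic a by apply: (eigenvalue_nbr_sum xv).
apply/eqP; rewrite eq_le; apply/andP; split.
  by apply: ge_sup => //; exists a.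
by apply: ub_le_sup => //; exists a.
Qed.

Lemma lambda_minP : exists x v, [/\ x v != 0,
   forall u, nbr_sum x u = lambda_min R G * x u &
   forall y, lambda_min R G * \sum_v y v ^+ 2 <= \sum_v y v * nbr_sum y v].
Proof.
have [|a [x [[v xv] hx hform]]] := @sym_kernel_max R G (fun s t => - (adj s t)%:R) g0.
  by move=> s t; rewrite adj_sym.
have hx' u : nbr_sum x u = - a * x u.
  by rewrite mulNr -hx nbr_sumE -sumrN; apply: eq_bigr => t _; rewrite mulNr opprK.
have hform' y : - a * \sum_v y v ^+ 2 <= \sum_v y v * nbr_sum y v.
  rewrite mulNr lerNl -nbr_sum_form -sumrN; apply: le_trans (hform y).
  rewrite le_eqVlt; apply/orP; left; apply/eqP; apply: eq_bigr => s _.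
  by rewrite -sumrN; apply: eq_bigr => t _; ring.
suff -> : lambda_min R G = - a by exists x, v.
have lb : lbound [set b : R | eigenvalue (adj_mx R G) b]%classic (- a).
  move=> b /nbr_sum_eigenvalue[y [w [yw hy]]].
  have := hform' y; rewrite (form_eigen hy) ler_pM2r //; exact: sum_sqr_gt0 yw.
have ea : [set b : R | eigenvalue (adj_mx R G) b]%classic (- a) by apply: (eigenvalue_nbr_sum xv).
apply/eqP; rewrite eq_le; apply/andP; split.
  by apply: ge_inf => //; exists (- a).
by apply: lb_le_inf => //; exists (- a).
Qed.

End Extremal.

(** * The incidence map between a graph and its line graph *)

Section Incidence.
Variables (R : realType) (G : sgraph).
Local Notation L := (line_graph G).
Implicit Types (v : G) (y : G -> R) (e f : L) (z : L -> R).

Lemma adj_neq (u v : G) : adj u v -> u != v.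
Proof. by move=> uv; apply/eqP => e; rewrite e adj_irr in uv. Qed.

Lemma edgesP (e : {set G}) :
  reflect (exists u v, adj u v /\ e = [set u; v]%SET) (e \in edges G).
Proof.
apply: (iffP imsetP) => [[[u v]]|[u [v [uv ->]]]].
  by rewrite inE => uv ->; exists u, v.
by exists (u, v) => //; rewrite inE.
Qed.

Lemma edge_set2 (u v : G) : ([set u; v]%SET \in edges G) = adj u v.
Proof.
apply/edgesP/idP => [[a [b [ab eqs]]]|uv]; last by exists u, v.
have : #|[set u; v]%SET| = 2 by rewrite eqs cards2 (adj_neq ab).
rewrite cards2; case: eqP => // /eqP uv _.
have : u \in [set a; b]%SET by rewrite -eqs !inE eqxx.
have : v \in [set a; b]%SET by rewrite -eqs !inE eqxx orbT.
rewrite !inE => /orP[]/eqP ? /orP[]/eqP ?; subst; rewrite ?eqxx // in uv *.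
by rewrite adj_sym.
Qed.

(** [endsum] is [B^T], [starsum] is [B], and [signless] is [D + A = B B^T]. *)
Definition endsum y (e : L) : R := \sum_(v in val e) y v.
Definition starsum z v : R := \sum_(e : L | v \in val e) z e.
Definition signless y v : R := \sum_(u | adj v u) (y v + y u).
Definition qform y : R := \sum_v y v * signless y v.

Lemma starsum_nbr (F : {set G} -> R) v :
  starsum (fun e => F (val e)) v = \sum_(u | adj v u) F [set v; u]%SET.
Proof.
pose S := [set [set v; u]%SET | u in [set u | adj v u]]%SET.
have inS (s : {set G}) : (s \in S) = (s \in edges G) && (v \in s).
  apply/imsetP/andP => [[u]|[/edgesP[a [b [ab ->]]]]].
    by rewrite inE => uv ->; rewrite edge_set2 uv !inE eqxx.
  rewrite !inE => /orP[]/eqP ->; first by exists b; rewrite ?inE.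
  by exists a; rewrite ?inE 1?adj_sym // finset.setUC.
transitivity (\sum_(a in S) F a); last first.
  rewrite big_imset /=; first by apply: eq_bigl => u; rewrite inE.
  move=> p q; rewrite !inE => vp vq /setP/(_ p); rewrite !inE eqxx orbT.
  by rewrite eq_sym (negbTE (adj_neq vp)) => /esym/eqP.
rewrite /starsum (eq_bigl (fun a => (a \in edges G) && (v \in a))) //.
by rewrite (big_sub_cond (edges G) (fun a => v \in a)).
Qed.

Lemma endsum_set2 y (e : L) u v : val e = [set u; v]%SET -> u != v ->
  endsum y e = y u + y v.
Proof. by rewrite /endsum => -> uv; rewrite big_setU1 ?big_set1 // inE. Qed.

Lemma starsum_endsum y v : starsum (endsum y) v = signless y v.
Proof.
rewrite (starsum_nbr (fun a => \sum_(u in a) y u)); apply: eq_bigr => u uv.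
by rewrite big_setU1 ?big_set1 // inE adj_neq.
Qed.

Lemma starsum_adjoint y z : \sum_e z e * endsum y e = \sum_v y v * starsum z v.
Proof.
rewrite /endsum /starsum; under eq_bigr => e _ do rewrite big_distrr big_mkcond /=.
rewrite exchange_big /=; apply: eq_bigr => v _; rewrite big_distrr /= [RHS]big_mkcond.
by apply: eq_bigr => e _; case: ifP => //; rewrite mulrC.
Qed.

(** [B^T B = 2 + A']: two distinct edges share at most one vertex, and an edge shares
    two with itself. *)
Lemma endsum_starsum z e : endsum (starsum z) e = 2 * z e + nbr_sum z e.
Proof.
rewrite /endsum /starsum (exchange_big_dep predT) //= (bigD1 e) //=; congr (_ + _).
  rewrite sumr_const -[LHS]mulr_natl; congr (_ * _).
  have /edgesP[u [v [uv ->]]] := valP e.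
  have -> : #|[pred i in [set u; v]%SET | i \in [set u; v]%SET]| = #|[set u; v]%SET|.
    by apply: eq_card => i; rewrite !inE andbb.
  by rewrite cards2 adj_neq.
rewrite /nbr_sum big_mkcond [RHS]big_mkcond; apply: eq_bigr => f _.
rewrite /adj /= /line_adj eq_sym; have [->|ne] //= := eqVneq f e.
have -> : \sum_(i in val e | i \in val f) z f = z f *+ #|val e :&: val f|.
  by rewrite sumr_const; congr (_ *+ _); apply: eq_card => i; rewrite !inE.
case: ifP => [|/negbFE/eqP ->]; last by rewrite cards0.
rewrite -card_gt0 => pos; suff -> : #|val e :&: val f| = 1 by rewrite mulr1n.
apply/eqP; rewrite eqn_leq pos andbT leqNgt; apply: contra_neqN ne => gt1.
have c2 (d : L) : #|val d| = 2.
  by have /edgesP[u [v [uv ->]]] := valP d; rewrite cards2 adj_neq.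
have ee : val e :&: val f = val e by apply/eqP; rewrite eqEcard subsetIl c2.
have ff : val e :&: val f = val f by apply/eqP; rewrite eqEcard subsetIr c2.
by apply: val_inj; rewrite -ff ee.
Qed.

Lemma starsum_sqr z : \sum_v starsum z v ^+ 2 = 2 * \sum_e z e ^+ 2 + \sum_e z e * nbr_sum z e.
Proof.
transitivity (\sum_e z e * endsum (starsum z) e).
  by rewrite starsum_adjoint; apply: eq_bigr => v _; rewrite expr2.
rewrite big_distrr -big_split /=; apply: eq_bigr => e _.
by rewrite endsum_starsum; ring.
Qed.

Lemma endsum_sqr y : \sum_e endsum y e ^+ 2 = qform y.
Proof.
rewrite /qform; under [RHS]eq_bigr => v _ do rewrite -starsum_endsum.
by rewrite -starsum_adjoint; apply: eq_bigr => e _; rewrite expr2.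
Qed.

Lemma signlessE y v : signless y v = #|[set u | adj v u]|%:R * y v + nbr_sum y v.
Proof.
rewrite /signless big_split /=; congr (_ + _); rewrite sumr_const -[LHS]mulr_natl.
by congr (_%:R * _); apply: eq_card => u; rewrite !inE.
Qed.

End Incidence.

Section LineGraphBounds.
Variables (R : realType) (G : sgraph) (e0 : line_graph G).
Local Notation L := (line_graph G).
Local Notation rho := (lambda_max R L + 2).
Local Notation sigma := (lambda_min R L + 2).
Implicit Types (y : G -> R).

Lemma sum_sqr_ge0 (T : finType) (F : T -> R) : 0 <= \sum_t F t ^+ 2.
Proof. by apply: sumr_ge0 => t _; apply: sqr_ge0. Qed.

Lemma starsum_max (z : L -> R) : \sum_v starsum z v ^+ 2 <= rho * \sum_e z e ^+ 2.
Proof.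
have [_ [_ [_ _ /(_ z) h]]] := lambda_maxP R e0.
by rewrite starsum_sqr mulrDl; lra.
Qed.

Lemma starsum_min (z : L -> R) : sigma * \sum_e z e ^+ 2 <= \sum_v starsum z v ^+ 2.
Proof.
have [_ [_ [_ _ /(_ z) h]]] := lambda_minP R e0.
by rewrite starsum_sqr mulrDl; lra.
Qed.

Lemma rho_gt0 : 0 < rho.
Proof.
have [_ [_ [_ _ /(_ (fun=> 1)) h]]] := lambda_maxP R e0.
suff : 0 <= lambda_max R L by lra.
have pos : 0 < \sum_(v : L) (1 : R) ^+ 2.
  by apply: (@sum_sqr_gt0 R L (fun=> 1) e0); apply: oner_neq0.
rewrite -(pmulr_lge0 _ pos); apply: le_trans h.
by apply: sumr_ge0 => v _; rewrite mul1r; apply: sumr_ge0.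
Qed.

(** The Rayleigh quotient of the line graph at [B^T y]. *)
Lemma signless_sqr_max y : \sum_v signless y v ^+ 2 <= rho * qform y.
Proof.
rewrite -endsum_sqr; apply: le_trans (starsum_max _).
by under [leRHS]eq_bigr => v _ do rewrite starsum_endsum.
Qed.

Lemma qform_max y : qform y <= rho * \sum_v y v ^+ 2.
Proof.
have := sum_sqr_ge0 (fun v => signless y v - rho * y v).
have -> : \sum_v (signless y v - rho * y v) ^+ 2
  = \sum_v signless y v ^+ 2 - 2 * rho * qform y + rho ^+ 2 * \sum_v y v ^+ 2.
  rewrite /qform !big_distrr -sumrB -big_split /=; apply: eq_bigr => v _; ring.
have := signless_sqr_max y; have := rho_gt0.
set r := rho; set q := qform y; set s := \sum_v y v ^+ 2; set t := \sum_v signless y v ^+ 2.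
move=> r0 h1 h2.
have : 0 <= r * (r * s - q) by lra.
by rewrite pmulr_rge0 // subr_ge0.
Qed.

(** The eigenvalue [q >= 0] of a minimal eigenvector [x] of [D + A] is transferred to
    the line graph by [endsum x]. This fails only if [q = 0], where [endsum x = 0]; the
    hypothesis, which says that no component of [G] is bipartite, excludes that. *)
Lemma qform_min y :
  (forall x : G -> R, (forall u v, adj u v -> x u + x v = 0) -> forall v, x v = 0) ->
  sigma * \sum_v y v ^+ 2 <= qform y.
Proof.
move=> nonbip.
pose K (s t : G) : R := - ((s == t)%:R * #|[set u | adj s u]|%:R + (adj s t)%:R).
have KE (x : G -> R) s : \sum_t K s t * x t = - signless x s.
  rewrite signlessE nbr_sumE /K.
  under eq_bigr => t _ do rewrite mulNr mulrDl.
  rewrite sumrN big_split /= (bigD1 s) //= eqxx mul1r big1 ?addr0 // => t /negbTE.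
  by rewrite eq_sym => ->; rewrite !mul0r.
have [e1 [e2 [_ _]]] : exists u v, adj u v /\ val e0 = [set u; v]%SET by apply/edgesP/valP.
have [|a [x [[v xv] hx hform]]] := @sym_kernel_max R G K e1.
  by move=> s t; rewrite /K adj_sym; have [->|_] := eqVneq s t; rewrite ?mul0r.
have hx' s : signless x s = - a * x s by rewrite mulNr -hx KE opprK.
have sx : 0 < \sum_v x v ^+ 2 by apply: (sum_sqr_gt0 xv).
have qx : qform x = - a * \sum_v x v ^+ 2.
  by rewrite /qform big_distrr; apply: eq_bigr => s _; rewrite hx' /=; ring.
have form (z : G -> R) : - a * \sum_v z v ^+ 2 <= qform z.
  rewrite mulNr lerNl; apply: le_trans _ (hform z); rewrite /qform -sumrN.
  apply: ler_sum => s _; rewrite -mulrN -KE big_distrr /=.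
  by apply: ler_sum => t _; rewrite mulrCA mulrA.
suff : sigma <= - a.
  by move=> h; apply: le_trans (form y); rewrite ler_wpM2r // sum_sqr_ge0.
have a0 : 0 <= - a by rewrite -(pmulr_lge0 _ sx) -qx -endsum_sqr sum_sqr_ge0.
have [a0'|a0'] := eqVneq (- a) 0.
  exfalso; move/eqP: xv; apply; apply: nonbip => u w uw.
  have : \sum_e endsum x e ^+ 2 = 0 by rewrite endsum_sqr qx a0' mul0r.
  move=> /eqP; rewrite psumr_eq0 => [|e _]; last exact: sqr_ge0.
  have ew : [set u; w]%SET \in edges G by rewrite edge_set2.
  pose e : L := exist (fun s : {set G} => s \in edges G) _ ew.
  move=> /allP/(_ e); rewrite mem_index_enum => /(_ isT).
  by rewrite sqrf_eq0 (@endsum_set2 R G x e u w erefl (adj_neq uw)) => /eqP.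
have := starsum_min (endsum x).
rewrite endsum_sqr.
under [X in _ <= X -> _]eq_bigr => s _ do rewrite starsum_endsum hx' exprMn.
rewrite -big_distrr /= qx.
have ap : 0 < - a by rewrite lt_neqAle eq_sym a0' a0.
move=> h; rewrite -(ler_pM2r (mulr_gt0 ap sx)); lra.
Qed.

End LineGraphBounds.

(** * Orienting a unicyclic graph towards its cycle *)

Section Orientations.
Local Open Scope nat_scope.

(** A unicyclic graph has as many edges as vertices, and its edges are the pairs
    [v, par v]: [par] goes round the cycle [cyc], and outside the cycle it lowers the
    distance [dep] to the cycle. Sums over edges thus become sums over vertices. *)
Record orientation (G : sgraph) (C : {set {set G}}) := Orientation {
  cyc : seq G;
  par : G -> G;
  dep : G -> nat;
  cyc_uniq : uniq cyc;
  cyc_size : size cyc = #|C|;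
  cyc_gt2 : 2 < size cyc;
  cyc_cover : forall v, (v \in finset.cover C) = (v \in cyc);
  adj_par : forall u v, adj u v = (v == par u) || (u == par v);
  par_par : forall v, par (par v) != v;
  par_cyc : forall v, v \in cyc -> par v = next cyc v;
  dep_eq0 : forall v, (dep v == 0) = (v \in cyc);
  dep_par : forall v, v \notin cyc -> dep v = (dep (par v)).+1;
  par_edge : forall v, ([set v; par v]%SET \in C) = (v \in cyc) }.

Section Unicyclic.
Variables (G : sgraph) (C : {set {set G}}).
Hypotheses (hG : connected_unicyclic G) (hC : is_cycle C).

Lemma cycle_unique (C' : {set {set G}}) : is_cycle C' -> C' = C.
Proof. by case: hG => _ [C0 [_ h]] /h <-; apply: h. Qed.

(** A second way from [u] to [v] closes up with the edge [uv] to a cycle through an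
    edge that is not in [C]. *)
Lemma bridge_off_cycle (u v : G) : adj u v -> [set u; v]%SET \notin C ->
  ~~ connect (del_adj [set [set u; v]]%SET) u v.
Proof.
move=> uv; apply: contraNN => /connectP[p0 p0path lastp0].
case/shortenP: p0path lastp0 => p pp up _ lastp.
have padj : path (@adj G) u p by apply: sub_path pp => x y /andP[].
have sp : 1 < size p.
  case: p pp lastp {up padj} => [|a [|b p]] //=; first by move=> _ e; rewrite e adj_irr in uv.
  by rewrite andbT /del_adj inE => /andP[_ +] e; rewrite e eqxx.
suff /cycle_unique <- : is_cycle (cycle_edges (v :: belast u p)).
  apply/imsetP; exists v; first by rewrite inE eqxx.
  by case: (p) sp => //= a s _; rewrite eqxx finset.setUC.
exists (v :: belast u p); split=> //; last by rewrite /= size_belast.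
have -> : v :: belast u p = rotr 1 (u :: p) by rewrite (lastI u p) -lastp rotr1_rcons.
rewrite /ucycle rotr_uniq rotr_cycle up andbT /= rcons_path padj -lastp.
by rewrite adj_sym.
Qed.

Lemma cycle_connect (F : {set {set G}}) (c : seq G) : ucycle (@adj G) c ->
  (forall x, x \in c -> [set x; next c x]%SET \notin F) ->
  {in c &, forall x y, connect (del_adj F) x y}.
Proof.
move=> /andP[cc uc] hF x y xc yc.
have cF : cycle (del_adj F) c.
  apply: cycle_from_next => // z zc.
  by rewrite /del_adj (next_cycle cc zc) hF.
have [i s es] := rot_to xc.
have : cycle (del_adj F) (x :: s) by rewrite -es rot_cycle.
rewrite /= rcons_path => /andP[ps _].
by apply: (path_connect ps); rewrite -es mem_rot.
Qed.

(** If an edge [uv] off the cycle were neither [u, par u] nor [v, par v], then iterating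
    [par] from [u] and from [v] would reach the cycle without using [uv], and the cycle
    would connect [u] to [v]; but [uv] is a bridge. *)
Lemma orientation_exists : exists o : orientation C, True.
Proof.
have [conG _] := hG; have [c [cc c2 eC]] := hC.
have /andP[cadj uc] := cc.
have [w0 w0c] : exists w, w \in c by case: (c) c2 => // w s _; exists w; rewrite inE eqxx.
pose reach v k := [exists p : k.-tuple G, path (@adj G) v p && (last v p \in c)].
have reachP v k : reflect (exists p, [/\ path (@adj G) v p, last v p \in c & size p = k]) (reach v k).
  apply: (iffP existsP) => [[p /andP[? ?]]|[p [h1 h2 /eqP h3]]].
    by exists p; rewrite size_tuple.
  by exists (Tuple h3); rewrite h1.
have exr v : exists k, reach v k.
  have /connectP[p pp lp] := conG v w0.
  by exists (size p); apply/reachP; exists p; rewrite -lp.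
pose d v := ex_minn (exr v).
have dreach v : reach v (d v) by rewrite /d; case: ex_minnP.
have dmin v k : reach v k -> d v <= k by rewrite /d; case: ex_minnP => m _; apply.
have d0 v : (d v == 0) = (v \in c).
  apply/eqP/idP => [e|vc].
    have := dreach v; rewrite e => /reachP[p [_ h /size0nil ep]].
    by rewrite ep in h.
  by apply/eqP; rewrite -leqn0; apply: dmin; apply/reachP; exists [::].
have dstep v : v \notin c -> exists a, adj v a && (d v == (d a).+1).
  move=> vc; have /reachP[[|a p] [/= pp lp sp]] := dreach v.
    by rewrite lp in vc.
  move/andP: pp => [va pp]; exists a; rewrite va /= eqn_leq; apply/andP; split.
    apply: dmin; have /reachP[q [qq lq sq]] := dreach a.
    by apply/reachP; exists (a :: q); rewrite /= va sq.
  by rewrite -sp ltnS; apply: dmin; apply/reachP; exists p.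
(* The default value [v] is never taken, by [dstep]. *)
pose pr v := if v \in c then next c v else odflt v [pick a | adj v a && (d v == (d a).+1)].
have prc v : v \in c -> pr v = next c v by rewrite /pr => ->.
have prn v : v \notin c -> adj v (pr v) /\ d v = (d (pr v)).+1.
  move=> vc; rewrite /pr (negbTE vc); case: pickP => [a /andP[? /eqP]|] //=.
  by have [a ha] := dstep _ vc => /(_ a); rewrite ha.
have pradj v : adj v (pr v).
  by have [vc|/prn[]//] := boolP (v \in c); rewrite prc // next_cycle.
have nextc v : v \in c -> next c v \in c by rewrite mem_next.
have next2 v : v \in c -> next c (next c v) != v.
  move=> vc; have [i s es] := rot_to vc.
  have us : uniq (rot i c) by rewrite rot_uniq.
  have ss : size (rot i c) = size c by rewrite size_rot.
  rewrite -!(next_rot i uc) es; rewrite es in us ss.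
  case: s us ss {es} => [|a [|b s]] /=; try by move=> _ ss; rewrite -ss in c2.
  rewrite !inE !negb_or => /andP[/and3P[va vb _] _] _.
  by rewrite eqxx [a == v]eq_sym (negbTE va) eqxx eq_sym.
have prpr v : pr (pr v) != v.
  have [vc|vc] := boolP (v \in c).
    by rewrite (prc _ vc) prc ?nextc // next2.
  have [_ dv] := prn _ vc.
  have [pc|pc] := boolP (pr v \in c).
    by rewrite (prc _ pc); apply: contraNneq vc => <-; rewrite nextc.
  have [_ dpv] := prn _ pc; apply/eqP => e; rewrite e in dpv; lia.
have edgeC x : x \in c -> [set x; next c x]%SET \in C.
  by move=> xc; rewrite eC; apply/imsetP; exists x.
have adjpr u v : adj u v = (v == pr u) || (u == pr v).
  apply/idP/orP => [uv|[]/eqP ->]; [|exact: pradj|by rewrite adj_sym].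
  apply/orP; apply: contraT; rewrite negb_or => /andP[vu uv'].
  have [eCuv|eCuv] := boolP ([set u; v]%SET \in C).
    move: eCuv; rewrite eC => /imsetP[x xc] /setP e.
    have := e u; have := e v; have := adj_neq uv; rewrite !inE !eqxx orbT /=.
    rewrite -(prc _ xc).
    move=> nuv /esym/orP[]/eqP ev /esym/orP[]/eqP eu; rewrite ev eu ?eqxx // in nuv vu uv'.
  pose F : {set {set G}} := [set [set u; v]]%SET.
  have prF x : [set x; pr x]%SET \notin F.
    rewrite inE; apply/eqP => /setP e.
    have := e x; have := e (pr x); have := adj_neq (pradj x).
    rewrite !inE !eqxx orbT /=.
    move=> nuv /esym/orP[]/eqP ev /esym/orP[]/eqP eu; move: nuv vu uv'; rewrite ?ev ?eu ?eqxx //.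
      by rewrite -ev eu eqxx.
    by rewrite -ev eu eqxx.
  have toC k x : d x = k -> exists2 z, z \in c & connect (del_adj F) x z.
    elim: k x => [|k IH] x dx; first by exists x; rewrite -?d0 ?dx.
    have xc : x \notin c by rewrite -d0 dx.
    have [_ dpr] := prn _ xc; have [|z zc cz] := IH (pr x); first by lia.
    exists z => //; apply: connect_trans cz; apply: connect1.
    by rewrite /del_adj pradj prF.
  have [z1 z1c c1] := toC _ u erefl; have [z2 z2c c2'] := toC _ v erefl.
  have /negP := bridge_off_cycle uv eCuv; case.
  apply: connect_trans c1 (connect_trans (cycle_connect cc _ z1c z2c) _).
    by move=> x xc; rewrite -(prc _ xc) prF.
  by rewrite (@sym_connect_sym _ (del_adj F)) //; apply: del_adj_sym.
have sC : size c = #|C|.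
  rewrite eC /cycle_edges card_in_imset ?(card_uniqP uc) //.
  move=> x y xc yc /setP e; have := e x; rewrite !inE eqxx /= => /esym/orP[/eqP //|/eqP ex].
  have := e y; rewrite !inE eqxx /= => /orP[/eqP //|/eqP ey].
  by have := next2 _ xc; rewrite -ey -ex eqxx.
have edgec v : ([set v; pr v]%SET \in C) = (v \in c).
  apply/idP/idP => [|vc]; last by rewrite prc ?edgeC.
  rewrite eC => /imsetP[x xc /setP e]; have := e v; rewrite !inE eqxx /=.
  by move=> /esym/orP[]/eqP -> //; rewrite nextc.
have cov v : (v \in finset.cover C) = (v \in c).
  apply/bigcupP/idP => [[s]|vc].
    by rewrite eC => /imsetP[x xc ->]; rewrite !inE => /orP[]/eqP -> //; rewrite nextc.
  by exists [set v; next c v]%SET; rewrite ?edgeC // !inE eqxx.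
by exists (Orientation uc sC c2 cov adjpr prpr prc d0 (fun v vc => (prn v vc).2) edgec).
Qed.

End Unicyclic.

End Orientations.

(** * The induced trees *)

Section InducedTrees.
Local Open Scope nat_scope.

Section Distance.
Variable G : sgraph.
Implicit Types x y : G.

(** A walk can be shortened to a path, which has fewer edges than [G] has vertices. *)
Lemma graph_dist_path x p : path (@adj G) x p -> graph_dist x (last x p) < #|G|.
Proof.
move=> /shortenP[q pq uq _]; set y := last x q.
have sq : size q < #|G| by rewrite -[(size q).+1]/(size (x :: q)) -(card_uniqP uq) max_card.
apply: (leq_ltn_trans _ sq); rewrite /graph_dist.
have [k ek] : exists k : 'I_#|G|, k = size q :> nat by exists (Ordinal sq).
rewrite -ek; have : [exists r : k.-tuple G, path (@adj G) x r && (last x r == y)].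
  apply/existsP; have sq' : size q == k by rewrite ek.
  by exists (Tuple sq'); rewrite /= pq eqxx.
have := mem_index_enum k; elim: (index_enum _) => //= a s IH.
rewrite inE big_cons => /orP[/eqP <- ->|ks hk]; first exact: geq_minl.
case: ifP => _; last exact: IH.
by apply: leq_trans (geq_minr _ _) (IH ks hk).
Qed.

Lemma leq_graph_dist x y m : m <= #|G| ->
  (forall p, path (@adj G) x p -> last x p = y -> m <= size p) -> m <= graph_dist x y.
Proof.
move=> mG hp; rewrite /graph_dist; elim/big_rec: _ => // k n /existsP[p /andP[pp /eqP lp]] mn.
by rewrite leq_min mn andbT -(size_tuple p) hp.
Qed.

Lemma graph_dist_diameter x y : graph_dist x y <= diameter G.
Proof.
apply: leq_trans (leq_bigmax x).
exact: (leq_bigmax (F := fun z => graph_dist x z) y).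
Qed.

Lemma diameter_lt_card : 0 < #|G| -> connected_graph G -> diameter G < #|G|.
Proof.
case EG : #|G| => [//|n] _ conn.
apply/bigmax_leqP => x _; apply/bigmax_leqP => y _.
have /connectP[p pp ->] := conn x y.
by rewrite -ltnS -EG graph_dist_path.
Qed.

Lemma diameter_gt0 x y : x != y -> 0 < diameter G.
Proof.
move=> xy; apply: leq_trans (graph_dist_diameter x y).
apply: leq_graph_dist => [|[|//] _ /= e]; first by apply/card_gt0P; exists x.
by rewrite e eqxx in xy.
Qed.

Lemma diameter_gt1 x y : x != y -> ~~ adj x y -> 1 < diameter G.
Proof.
move=> xy nxy; apply: leq_trans (graph_dist_diameter x y).
apply: leq_graph_dist => [|[|a [|//]] /=].
- by have := max_card (mem [set x; y]%SET); rewrite cards2 xy.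
- by move=> _ e; rewrite e eqxx in xy.
- by rewrite andbT => xa e; rewrite -e xa in nxy.
Qed.

Lemma component_connected x : connected_graph (component x).
Proof.
have lift p a (ha : a \in [set w | connect (@adj G) x w]%SET) : path (@adj G) a p ->
    exists hb, connect (@adj (component x)) (exist _ a ha) (exist _ (last a p) hb).
  elim: p a ha => [|b p IH] a ha /=; first by exists ha; apply: connect0.
  move=> /andP[ab pb].
  have hb : b \in [set w | connect (@adj G) x w]%SET.
    by rewrite inE; rewrite inE in ha; apply: connect_trans ha (connect1 ab).
  have [hl hc] := IH b hb pb; exists hl.
  by apply: connect_trans hc; apply: connect1.
have hx : x \in [set w | connect (@adj G) x w]%SET by rewrite inE connect0.
have from_x a : connect (@adj (component x)) (exist _ x hx) a.
  case: a => a ha; have := ha; rewrite inE => /connectP[p pp ea].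
  have [hl] := lift p x hx pp; rewrite -ea in hl *.
  by rewrite (bool_irrelevance hl ha).
move=> a b; apply: connect_trans (from_x b).
rewrite sym_connect_sym ?from_x //; exact: adj_sym.
Qed.

End Distance.

Section Trees.
Variables (G : sgraph) (C : {set {set G}}) (o : orientation C).
Local Notation cyc := (cyc o).
Local Notation par := (par o).
Local Notation dep := (dep o).

(** The root of the induced tree that contains [v]. *)
Definition anchor (v : G) : G := iter (dep v) par v.
Definition kids (v : G) : {set G} := [set u | (u \notin cyc) && (par u == v)]%SET.
Definition tree (v : G) : {set G} := [set u | (u \notin cyc) && (anchor u == v)]%SET.

Lemma anchor_cyc v : v \in cyc -> anchor v = v.
Proof. by rewrite /anchor -(dep_eq0 o) => /eqP ->. Qed.

Lemma anchor_par v : v \notin cyc -> anchor (par v) = anchor v.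
Proof. by rewrite /anchor => /(dep_par) ->; rewrite iterSr. Qed.

Lemma anchor_in v : anchor v \in cyc.
Proof.
have [k] := ubnP (dep v); elim: k v => // k IH v; rewrite ltnS => dk.
have [vc|vc] := boolP (v \in cyc); first by rewrite anchor_cyc.
by rewrite -anchor_par // IH // -ltnS -(dep_par vc) ltnS.
Qed.

Lemma par_in v : v \in cyc -> par v \in cyc.
Proof. by move=> vc; rewrite par_cyc // mem_next. Qed.

Lemma kids_tree v : v \in cyc -> kids v \subset tree v.
Proof.
move=> vc; apply/fintype.subsetP => u; rewrite !inE => /andP[uc /eqP pu].
by rewrite uc -anchor_par // pu anchor_cyc /=.
Qed.

Lemma adj_del_par v : v \notin cyc -> del_adj C v (par v).
Proof. by move=> vc; rewrite /del_adj (adj_par o) eqxx /= par_edge. Qed.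

Lemma connect_anchor v : connect (del_adj C) (anchor v) v.
Proof.
have [k] := ubnP (dep v); elim: k v => // k IH v; rewrite ltnS => dk.
have [vc|vc] := boolP (v \in cyc); first by rewrite anchor_cyc // connect0.
rewrite -anchor_par //; apply: connect_trans (IH _ _) (connect1 _).
  by rewrite -ltnS -(dep_par vc) ltnS.
by rewrite del_adj_sym adj_del_par.
Qed.

Lemma connect_eq_anchor u v : connect (del_adj C) u v -> anchor u = anchor v.
Proof.
have step a b : del_adj C a b -> anchor a = anchor b.
  have one c : [set c; par c]%SET \notin C -> anchor (par c) = anchor c.
    by rewrite par_edge; apply: anchor_par.
  rewrite /del_adj (adj_par o) => /andP[/orP[]/eqP -> h]; first by rewrite one.
  by rewrite one // finset.setUC.
move=> /connectP[p pp ->]; elim: p u pp => //= a p IH u /andP[/step -> pp].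
exact: IH.
Qed.

Lemma rooted_tree_mem v u : v \in cyc ->
  (u \in [set w | connect (@adj (del_edges C)) v w]%SET) = (anchor u == v).
Proof.
move=> vc; rewrite inE; apply/idP/eqP => [/connect_eq_anchor <-|<-].
  exact: anchor_cyc.
exact: connect_anchor.
Qed.

Lemma card_rooted_tree v : v \in cyc -> #|rooted_tree C v| = #|tree v|.+1.
Proof.
move=> vc; rewrite card_sig.
have -> : #|tree v|.+1 = #|v |: tree v| by rewrite cardsU1 !inE vc.
apply: eq_card => u; rewrite -[LHS]/(u \in [set w | connect (@adj (del_edges C)) v w]%SET).
rewrite rooted_tree_mem // !inE.
have [->|uv] := eqVneq u v; first by rewrite anchor_cyc ?eqxx.
case: (boolP (u \in cyc)) => //= uc; by rewrite anchor_cyc // (negbTE uv).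
Qed.

(** The diameter of a connected graph is smaller than its number of vertices. This is
    the only property of a large diameter that the upper bound for [sigma] uses. *)
Lemma diameter_rooted_tree v : v \in cyc -> diameter (rooted_tree C v) <= #|tree v|.
Proof.
move=> vc; rewrite -ltnS -card_rooted_tree //; apply: diameter_lt_card.
  by rewrite card_rooted_tree.
exact: component_connected.
Qed.

(** The configurations that are impossible for [h = 0] and for [h = 1]. *)
Lemma rooted_tree_far u v : u != v -> anchor u = anchor v ->
  0 < max_tree_diameter C /\ (~~ adj u v -> 1 < max_tree_diameter C).
Proof.
move=> uv ruv; have rc := anchor_in u.
have hu : u \in [set w | connect (@adj (del_edges C)) (anchor u) w]%SET.
  by rewrite rooted_tree_mem.
have hv : v \in [set w | connect (@adj (del_edges C)) (anchor u) w]%SET.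
  by rewrite rooted_tree_mem // -ruv.
have le : diameter (rooted_tree C (anchor u)) <= max_tree_diameter C.
  rewrite /max_tree_diameter.
  apply: (@leq_bigmax_cond _ _ (fun v => diameter (rooted_tree C v))).
  by rewrite (cyc_cover o).
pose a : rooted_tree C (anchor u) := exist _ u hu.
pose b : rooted_tree C (anchor u) := exist _ v hv.
have ab : a != b by apply: contraNneq uv => /(congr1 val) /= ->.
split=> [|nuv]; first by apply: leq_trans le; apply: diameter_gt0 ab.
apply: leq_trans le; apply: diameter_gt1 ab _.
by rewrite /adj /= /induced_adj /adj /= /del_adj (negbTE nuv).
Qed.

Lemma largest_tree :
  exists2 w, w \in cyc & max_tree_diameter C = diameter (rooted_tree C w).
Proof.
have [|w] := @eq_bigmax_cond _ (mem (finset.cover C)) (fun v => diameter (rooted_tree C v)).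
  have := cyc_gt2 o; case E : cyc => [//|w s] _.
  by apply/card_gt0P; exists w; rewrite (cyc_cover o) E inE eqxx.
by rewrite (cyc_cover o) => wc e; exists w.
Qed.

(** Otherwise [u] and [par (par u)] lie in one tree, and are distinct and not adjacent. *)
Lemma tree_depth1 u : max_tree_diameter C <= 1 -> u \notin cyc -> par u \in cyc.
Proof.
move=> h1 uc; apply: contraT => tc.
have us : u != par (par u) by rewrite eq_sym par_par.
have [|_] := rooted_tree_far us; first by rewrite !anchor_par.
move=> far; suff : 1 < max_tree_diameter C by lia.
apply: far.
rewrite (adj_par o) negb_or; apply/andP; split.
  by apply/eqP => e; have := par_par o (par u); rewrite e e eqxx.
have d1 := dep_par uc; have d2 := dep_par tc.
apply/eqP => e; have [sc|sc] := boolP (par (par u) \in cyc).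
  by have := par_in sc; rewrite -e (negbTE uc).
have := dep_par sc; rewrite -e; lia.
Qed.

(** Two children of [v] are not adjacent, by the orientation of the edges. *)
Lemma kids_le1 v : max_tree_diameter C <= 1 -> v \in cyc -> #|kids v| <= 1.
Proof.
move=> h1 vc; rewrite leqNgt; apply/negP => /card_gt1P[a [b [ha hb ab]]].
move: ha hb; rewrite !inE => /andP[ac /eqP pa] /andP[bc /eqP pb].
have [|_] := rooted_tree_far ab; first by rewrite -(anchor_par ac) -(anchor_par bc) pa pb.
move=> far; suff : 1 < max_tree_diameter C by lia.
apply: far.
by rewrite (adj_par o) pa pb negb_or; apply/andP; split;
  [apply: contraNneq bc | apply: contraNneq ac] => ->.
Qed.

Lemma no_tree : max_tree_diameter C = 0 -> forall v, v \in cyc.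
Proof.
move=> h0 v; apply: contraT => vc.
have ne : v != par v by apply: adj_neq; rewrite (adj_par o) eqxx.
by have [|+ _] := rooted_tree_far ne; rewrite ?anchor_par // h0.
Qed.

End Trees.

End InducedTrees.

(** * Sums over the oriented edges, and test vectors *)

Section OrientedSums.
Variables (R : realType) (G : sgraph) (C : {set {set G}}) (o : orientation C).
Local Notation cyc := (cyc o).
Local Notation par := (par o).
Local Notation dep := (dep o).
Local Notation anchor := (anchor o).
Implicit Types (x y f : G -> R).

Lemma sum_nbr f v : \sum_(u | adj v u) f u = f (par v) + \sum_(u | par u == v) f u.
Proof.
rewrite (bigD1 (par v)) /=; last by rewrite (adj_par o) eqxx.
congr (_ + _); apply: eq_bigl => u; rewrite (adj_par o) [v == _]eq_sym.
have [->|_] /= := eqVneq u (par v); last by rewrite andbT.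
by rewrite (negbTE (par_par o v)).
Qed.

Lemma sum_fibers f : \sum_v \sum_(u | par u == v) f u = \sum_u f u.
Proof. by rewrite [RHS](partition_big par predT). Qed.

Lemma sum_fibersM (f h : G -> R) :
  \sum_v h v * (\sum_(u | par u == v) f u) = \sum_u h (par u) * f u.
Proof.
rewrite [RHS](partition_big par predT) //=; apply: eq_bigr => v _.
by rewrite big_distrr; apply: eq_bigr => u /eqP ->.
Qed.

Lemma nbr_sum_par x v : nbr_sum x v = x (par v) + \sum_(u | par u == v) x u.
Proof. exact: sum_nbr. Qed.

Lemma qform_par y : qform y = \sum_v (y v + y (par v)) ^+ 2.
Proof.
rewrite /qform /signless.
transitivity (\sum_v (y v * (y v + y (par v)) + y v * \sum_(u | par u == v) (y v + y u))).
  by apply: eq_bigr => v _; rewrite sum_nbr mulrDr.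
rewrite big_split /=.
transitivity (\sum_v y v * (y v + y (par v)) + \sum_v \sum_(u | par u == v) y (par u) * (y (par u) + y u)).
  congr (_ + _); apply: eq_bigr => v _; rewrite big_distrr.
  by apply: eq_bigr => u /eqP ->.
rewrite sum_fibers -big_split /=; apply: eq_bigr => v _; ring.
Qed.

(** [x] changes sign along each edge, so going round an odd cycle gives [x v = - x v]. *)
Lemma odd_cycle_rigid (godd : odd #|C|) x :
  (forall u v, adj u v -> x u + x v = 0) -> forall v, x v = 0.
Proof.
move=> hx.
have flip p u : path (@adj G) u p -> x (last u p) = (-1) ^+ size p * x u.
  elim: p u => [|a p IH] u /=; first by rewrite mul1r.
  move=> /andP[/hx ua /IH ->]; rewrite exprS.
  have -> : x a = - x u by apply/eqP; rewrite -addr_eq0 addrC ua.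
  by ring.
have cyc0 v : v \in cyc -> x v = 0.
  move=> vc; have [i s es] := rot_to vc.
  have cc : cycle (@adj G) cyc.
    apply: cycle_from_next => [|u uc]; first exact: cyc_uniq.
    by rewrite -(par_cyc uc) (adj_par o) eqxx.
  have : cycle (@adj G) (v :: s) by rewrite -es rot_cycle.
  move=> /flip; rewrite last_rcons size_rcons -[(size s).+1]/(size (v :: s)) -es size_rot.
  by rewrite (cyc_size o) -signr_odd godd expr1 mulN1r; lra.
move=> v; have [k] := ubnP (dep v); elim: k v => // k IH v; rewrite ltnS => dk.
have [/cyc0//|vc] := boolP (v \in cyc).
have := hx v (par v); rewrite (adj_par o) eqxx (IH (par v)); first by rewrite addr0; apply.
by rewrite -ltnS -(dep_par vc) ltnS.
Qed.

Lemma cyc_gt0 : (0 < size cyc)%N.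
Proof. exact: leq_trans (cyc_gt2 o). Qed.

(** The index of [par v] is that of [v] plus one, except at the end of the list [cyc],
    where it wraps round to 0. *)
Lemma sum_cyc (F : nat -> nat -> R) :
  \sum_(v in cyc) F (index v cyc) (index (par v) cyc)
    = \sum_(0 <= i < (size cyc).-1) F i i.+1 + F (size cyc).-1 0%N.
Proof.
have [w0 w0c] : exists w, w \in cyc.
  by have := cyc_gt0; case: cyc => // w s _; exists w; rewrite inE eqxx.
rewrite -big_uniq ?cyc_uniq //= (big_nth w0).
have e := prednK cyc_gt0; rewrite -{1}e big_nat_recr //=.
have idx i : (i < size cyc)%N -> index (nth w0 cyc i) cyc = i.
  by move=> hi; rewrite index_uniq ?cyc_uniq.
have parn i : (i < size cyc)%N -> par (nth w0 cyc i) = nth (nth w0 cyc 0) cyc i.+1.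
  move=> hi; rewrite par_cyc ?mem_nth // next_nth mem_nth //.
  have E : cyc = nth w0 cyc 0 :: behead cyc by case: (cyc) cyc_gt0.
  by rewrite [in LHS]E -E idx // nth_behead.
congr (_ + _).
  rewrite big_nat [RHS]big_nat; apply: eq_bigr => i /andP[_ hi].
  have hi' : (i.+1 < size cyc)%N by lia.
  by rewrite parn ?(ltnW hi') // (set_nth_default w0) // !idx // ltnW.
rewrite parn ?e // [nth (nth _ _ _) _ _]nth_default // !idx ?cyc_gt0 //.
by rewrite ltn_predL cyc_gt0.
Qed.

Lemma sum_cyc1 (F : nat -> R) :
  \sum_(v in cyc) F (index v cyc) = \sum_(0 <= i < size cyc) F i.
Proof.
rewrite (sum_cyc (fun i _ => F i)) -[in RHS](prednK cyc_gt0).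
by rewrite big_nat_recr.
Qed.

End OrientedSums.

(** Test vectors are given by the position on the cycle, counted from [w]. *)
Lemma orientation_rot (G : sgraph) (C : {set {set G}}) (o : orientation C) (w : G) :
  w \in cyc o -> exists o' : orientation C, index w (cyc o') = 0%N.
Proof.
move=> wc; have [i s es] := rot_to wc.
have mr : cyc o =i w :: s by move=> v; rewrite -es mem_rot.
have us : uniq (w :: s) by rewrite -es rot_uniq cyc_uniq.
have ss : size (w :: s) = #|C| by rewrite -es size_rot (cyc_size o).
have s2 : (2 < size (w :: s))%N by rewrite -es size_rot (cyc_gt2 o).
have cov v : (v \in finset.cover C) = (v \in w :: s) by rewrite (cyc_cover o) mr.
have pc v : v \in w :: s -> par o v = next (w :: s) v.
  by rewrite -mr -es next_rot ?cyc_uniq //; apply: par_cyc.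
have d0 v : (dep o v == 0%N) = (v \in w :: s) by rewrite (dep_eq0 o) mr.
have dp v : v \notin w :: s -> dep o v = (dep o (par o v)).+1 by rewrite -mr; apply: dep_par.
have pe v : ([set v; par o v]%SET \in C) = (v \in w :: s) by rewrite (par_edge o) mr.
exists (Orientation us ss s2 cov (adj_par o) (par_par o) pc d0 dp pe).
by rewrite /= eqxx.
Qed.

Section TestVectors.
Variables (R : realType) (G : sgraph) (C : {set {set G}}) (o : orientation C).
Variable e0 : line_graph G.
Local Notation cyc := (cyc o).
Local Notation par := (par o).
Local Notation dep := (dep o).
Local Notation anchor := (anchor o).
Local Notation g := (size cyc).
Local Notation rho := (lambda_max R (line_graph G) + 2).
Local Notation sigma := (lambda_min R (line_graph G) + 2).
Implicit Types (phi psi f : nat -> R).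

Lemma sum_kids (h : G -> R) :
  \sum_(v | (v \notin cyc) && (par v \in cyc)) h v = \sum_(w in cyc) \sum_(v in kids o w) h v.
Proof.
rewrite (partition_big par (mem cyc)) => [|v /andP[]//]; apply: eq_bigr => w wc.
apply: eq_bigl => v; rewrite inE -andbA; case: (v \notin cyc) => //=.
by case: eqP => [->|_]; rewrite ?andbF // andbT.
Qed.

(** The form of [D + A] on the cycle, at the vector with values [(-1) ^ i * f i]. The last
    term has a plus sign since the girth is odd. *)
Definition alt_sum f : R := \sum_(0 <= i < g.-1) (f i - f i.+1) ^+ 2 + (f g.-1 + f 0%N) ^+ 2.
Definition cyc_sum phi : R := \sum_(0 <= i < g.-1) (phi i + phi i.+1) ^+ 2 + (phi g.-1 + phi 0%N) ^+ 2.

(** The test vector takes the value [phi i] at the position [i] of the cycle and [psi i] at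
    its neighbours off the cycle, and vanishes elsewhere. The edges that leave its
    support only increase the form. *)
Lemma rho_test phi psi :
  cyc_sum phi + \sum_(w in cyc) #|kids o w|%:R * (phi (index w cyc) + psi (index w cyc)) ^+ 2
  <= rho * (\sum_(0 <= i < g) phi i ^+ 2 + \sum_(w in cyc) #|kids o w|%:R * psi (index w cyc) ^+ 2).
Proof.
pose y v := if v \in cyc then phi (index v cyc)
            else if par v \in cyc then psi (index (par v) cyc) else 0.
have yc v : v \in cyc -> y v = phi (index v cyc) by rewrite /y => ->.
have yk w v : w \in cyc -> v \in kids o w -> y v = psi (index w cyc) /\ par v = w.
  by move=> wc; rewrite inE => /andP[vc /eqP pv]; rewrite /y (negbTE vc) pv wc.
have -> : \sum_(0 <= i < g) phi i ^+ 2 + \sum_(w in cyc) #|kids o w|%:R * psi (index w cyc) ^+ 2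
    = \sum_v y v ^+ 2.
  rewrite [RHS](bigID (mem cyc)) /=; congr (_ + _).
    by rewrite -(sum_cyc1 o (fun i => phi i ^+ 2)); apply: eq_bigr => v /yc ->.
  rewrite [RHS](bigID (fun v => par v \in cyc)) /= sum_kids.
  rewrite [X in _ = _ + X]big1 => [|v /andP[/negbTE vc /negbTE pc]]; last first.
    by rewrite /y vc pc expr0n.
  rewrite addr0; apply: eq_bigr => w wc.
  by under eq_bigr => v /(yk _ _ wc)[-> _] do []; rewrite sumr_const mulr_natl.
apply: le_trans (qform_max e0 y); rewrite (qform_par o) [leRHS](bigID (mem cyc)) /=.
apply: lerD.
  rewrite /cyc_sum -(sum_cyc o (fun i j => (phi i + phi j) ^+ 2)).
  by rewrite le_eqVlt; apply/orP; left; apply/eqP; apply: eq_bigr => v vc; rewrite !yc ?par_in.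
rewrite [leRHS](bigID (fun v => par v \in cyc)) /= sum_kids -[leLHS]addr0; apply: lerD.
  rewrite le_eqVlt; apply/orP; left; apply/eqP; apply: eq_bigr => w wc.
  under eq_bigr => v /(yk _ _ wc)[-> ->] do [].
  by rewrite sumr_const (yc w wc) mulr_natl addrC.
by apply: sumr_ge0 => v _; apply: sqr_ge0.
Qed.

(** The test vector alternates in sign along the edges. Its absolute value is [t] on the
    tree at [w] without [w], and constant, equal to [f] at the root, on every other
    tree. So apart from the edges of the cycle only those from [w] into its tree
    contribute to the form. *)
Lemma sigma_test (godd : odd #|C|) w f t : index w cyc = 0%N ->
  sigma * (\sum_(0 <= i < g) f i ^+ 2 + #|tree o w|%:R * t ^+ 2)
  <= alt_sum f + #|kids o w|%:R * (t - f 0%N) ^+ 2.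
Proof.
move=> w0; have wc : w \in cyc by rewrite -index_mem w0 cyc_gt0.
have rhs0 : 0 <= alt_sum f + #|kids o w|%:R * (t - f 0%N) ^+ 2.
  apply: addr_ge0; last by rewrite mulr_ge0 // sqr_ge0.
  by apply: addr_ge0; [apply: sumr_ge0 => *|]; apply: sqr_ge0.
(* The comparison of the norms below needs [sigma] to be positive. *)
have [s0|s0] := leP sigma 0.
  apply: le_trans rhs0; rewrite -oppr_ge0 -mulNr mulr_ge0 ?oppr_ge0 //.
  by apply: addr_ge0; [apply: sumr_ge0 => *|rewrite mulr_ge0]; rewrite ?sqr_ge0.
pose val v := if (v \notin cyc) && (anchor v == w) then t else f (index (anchor v) cyc).
pose y v := (-1) ^+ (dep v + index (anchor v) cyc) * val v.
have y2 v : y v ^+ 2 = val v ^+ 2 by rewrite /y exprMn sqrr_sign mul1r.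
have yc v : v \in cyc -> y v = (-1) ^+ index v cyc * f (index v cyc).
  move=> vc; have /eqP dv : dep v == 0%N by rewrite dep_eq0.
  by rewrite /y /val vc dv anchor_cyc.
have ypar v : v \notin cyc -> (y v + y (par v)) ^+ 2 = (val v - val (par v)) ^+ 2.
  move=> vc; rewrite /y (dep_par vc) anchor_par // addSn [(-1) ^+ _.+1]exprS.
  have := sqrr_sign R (dep (par v) + index (anchor v) cyc); set s := _ ^+ (_ + _) => s2.
  by rewrite -[RHS]mul1r -[X in _ = X * _]s2; ring.
have vroot v : v \notin cyc -> v \notin tree o w -> val v = val (par v).
  move=> vc; rewrite inE vc /= => rv; rewrite /val vc anchor_par // (negbTE rv).
  by rewrite !andbF.
have vtree v : v \in tree o w -> val v = t.
  by rewrite inE /val => ->.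
have vw : val w = f 0%N by rewrite /val wc anchor_cyc ?w0.
have := qform_min e0 y (odd_cycle_rigid o godd).
have hm : \sum_(0 <= i < g) f i ^+ 2 + #|tree o w|%:R * t ^+ 2 <= \sum_v y v ^+ 2.
  rewrite (bigID (mem cyc)) /=; apply: lerD.
    rewrite -(sum_cyc1 o (fun i => f i ^+ 2)) le_eqVlt; apply/orP; left; apply/eqP.
    by apply: eq_bigr => v vc; rewrite yc // exprMn sqrr_sign mul1r.
  rewrite (bigID (mem (tree o w))) /= -[leLHS]addr0; apply: lerD; last first.
    by apply: sumr_ge0 => v _; apply: sqr_ge0.
  rewrite le_eqVlt; apply/orP; left; apply/eqP.
  rewrite (eq_bigl (mem (tree o w))) => [|v]; last first.
    by rewrite !inE; case: (v \in cyc).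
  under eq_bigr => v vt do rewrite y2 vtree //.
  by rewrite sumr_const mulr_natl.
move=> hq; apply: le_trans (ler_wpM2l (ltW s0) hm) _; apply: le_trans hq _.
rewrite (qform_par o) (bigID (mem cyc)) /=; apply: lerD.
  rewrite /alt_sum le_eqVlt; apply/orP; left; apply/eqP.
  transitivity (\sum_(v in cyc) ((-1) ^+ index v cyc * f (index v cyc)
     + (-1) ^+ index (par v) cyc * f (index (par v) cyc)) ^+ 2).
    by apply: eq_bigr => v vc; rewrite !yc ?par_in.
  rewrite (sum_cyc o (fun i j => ((-1) ^+ i * f i + (-1) ^+ j * f j) ^+ 2)); congr (_ + _).
    apply: eq_bigr => i _; rewrite [(-1) ^+ _.+1]exprS.
    have := sqrr_sign R i; set s := _ ^+ i => s2.
    by rewrite -[RHS]mul1r -[X in _ = X * _]s2; ring.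
  have ge : odd g.-1 = false.
    by move: godd (cyc_gt0 o); rewrite -(cyc_size o); case: (g) => //= n /negbTE.
  by rewrite -signr_odd ge !expr0 !mul1r.
have -> : \sum_(v | v \notin cyc) (y v + y (par v)) ^+ 2
   = \sum_(v in kids o w) (t - f 0%N) ^+ 2.
  rewrite (bigID (mem (kids o w))) /= [X in _ + X]big1 ?addr0; last first.
    move=> v /andP[vc]; rewrite inE vc /= => pv; rewrite ypar //.
    have [vt|vt] := boolP (v \in tree o w); last by rewrite vroot // subrr expr0n.
    rewrite (vtree _ vt) (vtree (par v)) ?subrr ?expr0n //.
    move: vt; rewrite !inE vc /= -(anchor_par vc) => /eqP rp; rewrite rp eqxx andbT.
    by apply: contraNN pv => pc; rewrite -rp anchor_cyc.
  rewrite (eq_bigl (mem (kids o w))) => [|v]; last first.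
    by rewrite !inE; case: (v \in cyc).
  apply: eq_bigr => v vk; have vt := fintype.subsetP (kids_tree wc) _ vk.
  have : v \in kids o w by [].
  rewrite inE => /andP[vc /eqP pv].
  by rewrite ypar // (vtree _ vt) pv vw.
by rewrite sumr_const mulr_natl.
Qed.

End TestVectors.

(** * The gap between [rho] and twice the largest eigenvalue of [G] *)

Section Gap.
Variables (R : realType) (G : sgraph) (C : {set {set G}}) (o : orientation C).
Variable e0 : line_graph G.
Local Notation par := (par o).
Local Notation rho := (lambda_max R (line_graph G) + 2).
Variables (x : G -> R) (l : R) (v0 : G).
Hypotheses (x0 : x v0 != 0) (hx : forall v, nbr_sum x v = l * x v) (l0 : 0 <= l).

Local Notation fib v := [set u | par u == v]%SET.
Local Notation c v := (#|fib v|%:R : R).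

Lemma signless_eigen v : signless x v = (l + 1 + c v) * x v.
Proof.
rewrite signlessE hx.
have -> : #|[set u | adj v u]| = #|fib v|.+1.
  have -> : [set u | adj v u]%SET = (par v |: fib v)%SET.
    by apply/setP => u; rewrite !inE (adj_par o) [v == _]eq_sym.
  by rewrite cardsU1 inE par_par.
by rewrite -natr1; ring.
Qed.

Lemma sum_fib (f : G -> R) v : \sum_(u | par u == v) f u = \sum_(u in fib v) f u.
Proof. by apply: eq_bigl => u; rewrite inE. Qed.

Lemma sum_par_sqr : \sum_v x (par v) ^+ 2 = \sum_v c v * x v ^+ 2.
Proof.
rewrite -(sum_fibers o); apply: eq_bigr => v _.
under eq_bigr => u /eqP -> do [].
by rewrite sum_fib sumr_const mulr_natl.
Qed.

(** The test vector [B^T x] gives the gap [gam] if the sum over the vertices [v], with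
    [c] in-neighbours, of
<<
      (l + 1 + c) (1 + c - l - gam) (x v)^2
>>
    is nonnegative. Adding multiples [al] and [k] of the two vanishing sums
<<
      sum_v ((x (par v))^2 - c (x v)^2),   sum_v ((sum_(par u = v) (x u)^2) - (x v)^2)
>>
    makes every summand nonnegative. Indeed the squares [(x u - th x v)^2] and
    [(x (par v) - eta x v)^2] bound the new terms below linearly, and for
    [al eta = k th] the eigenvector equation turns this bound into a multiple
    of [(x v)^2], the one in the hypothesis. *)
Lemma gap_certificate (al k gam : R) : 0 < al -> 0 <= k ->
  (forall n : nat, exists th,
     0 <= (l + 1 + n%:R) * (1 + n%:R - l - gam) - al * n%:R - k
          + k * (2 * th * l - th ^+ 2 * (k / al + n%:R))) ->
  gam <= rho - 2 * l.
Proof.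
move=> al0 k0 cert.
have qe : qform x = \sum_v (l + 1 + c v) * x v ^+ 2.
  by rewrite /qform; apply: eq_bigr => v _; rewrite signless_eigen; ring.
have qpos : 0 < qform x.
  apply: lt_le_trans (sum_sqr_gt0 x0) _; rewrite qe; apply: ler_sum => v _.
  have := mulr_ge0 (addr_ge0 l0 (ler0n R #|fib v|)) (sqr_ge0 (x v)); lra.
have := signless_sqr_max e0 x.
suff h : (2 * l + gam) * qform x <= \sum_v signless x v ^+ 2.
  by move=> /(le_trans h); rewrite ler_pM2r //; lra.
rewrite -subr_ge0.
have -> : \sum_v signless x v ^+ 2 - (2 * l + gam) * qform x
  = \sum_v ((l + 1 + c v) * (1 + c v - l - gam) * x v ^+ 2
    + al * (x (par v) ^+ 2 - c v * x v ^+ 2)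
    + k * (\sum_(u | par u == v) x u ^+ 2 - x v ^+ 2)).
  rewrite !big_split /= -!big_distrr /= !sumrB sum_par_sqr (sum_fibers o) !subrr !mulr0 !addr0.
  rewrite qe big_distrr -sumrB; apply: eq_bigr => v _.
  by rewrite signless_eigen /=; ring.
apply: sumr_ge0 => v _.
have [th hth] := cert #|fib v|.
have hS : \sum_(u | par u == v) x u = l * x v - x (par v) by rewrite -hx (nbr_sum_par o) addrAC subrr add0r.
have hR : 2 * th * x v * (l * x v - x (par v)) - c v * th ^+ 2 * x v ^+ 2
      <= \sum_(u | par u == v) x u ^+ 2.
  have : 0 <= \sum_(u | par u == v) (x u - th * x v) ^+ 2 by apply: sumr_ge0 => *; apply: sqr_ge0.
  have -> : \sum_(u | par u == v) (x u - th * x v) ^+ 2 = \sum_(u | par u == v) x u ^+ 2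
     - 2 * th * x v * (\sum_(u | par u == v) x u) + c v * (th * x v) ^+ 2.
    rewrite -[X in _ + X](_ : \sum_(u | par u == v) (th * x v) ^+ 2 = _); last first.
      by rewrite sum_fib sumr_const mulr_natl.
    rewrite big_distrr -sumrB -big_split /=; apply: eq_bigr => u _; ring.
  by rewrite hS; lra.
have ka : k = al * (k / al) by rewrite mulrCA divff ?mulr1 // gt_eqF.
have hP : 0 <= al * (x (par v) - k / al * th * x v) ^+ 2 by apply: mulr_ge0; [exact: ltW|exact: sqr_ge0].
move: hR hP hth; set S := \sum_(u | _) _; move: (k / al) ka => u ka.
move: (c v) (x v) (x (par v)) (S) => n X P Q hR hP hth.
have : 0 <= k * (Q - (2 * th * X * (l * X - P) - n * th ^+ 2 * X ^+ 2)).
  by rewrite mulr_ge0 // subr_ge0.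
have := mulr_ge0 hth (sqr_ge0 X).
rewrite ka in hP hth *; lra.
Qed.

(** From [D + A] alone: the sum of [(x (par v) - l / 2 * x v)^2] is nonnegative, which
    bounds the mean of the in-degrees for the weights [(x v)^2] below by [l^2 / 4]. This is
    enough for large [l], where the certificates with constant multipliers fail. *)
Lemma gap_square : (1 - l / 2) ^+ 2 <= rho - 2 * l.
Proof.
have := qform_max e0 x; set s := \sum_v x v ^+ 2.
have s0 : 0 < s by apply: sum_sqr_gt0 x0.
suff h : (1 + l / 2) ^+ 2 * s <= qform x.
  by move=> /(le_trans h); rewrite ler_pM2r //; lra.
have qe : qform x = (l + 1) * s + \sum_v c v * x v ^+ 2.
  rewrite /qform /s big_distrr -big_split; apply: eq_bigr => v _.
  by rewrite signless_eigen /=; ring.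
have hXP : 2 * \sum_v x v * x (par v) = l * s.
  rewrite /s -(form_eigen hx) mulr_natl mulr2n.
  transitivity (\sum_v x v * x (par v) + \sum_v x v * \sum_(u | par u == v) x u).
    by rewrite (sum_fibersM o); congr (_ + _); apply: eq_bigr => v _; rewrite mulrC.
  by rewrite -big_split /=; apply: eq_bigr => v _; rewrite (nbr_sum_par o) mulrDr.
have : 0 <= \sum_v (x (par v) - l / 2 * x v) ^+ 2 by apply: sum_sqr_ge0.
have -> : \sum_v (x (par v) - l / 2 * x v) ^+ 2 = \sum_v c v * x v ^+ 2
   - l * (\sum_v x v * x (par v)) + (l / 2) ^+ 2 * s.
  rewrite -sum_par_sqr /s !big_distrr -sumrB -big_split /=; apply: eq_bigr => v _; by field.
have : l * \sum_v x v * x (par v) = l * (l * s) / 2 by rewrite -hXP; field.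
by rewrite qe; lra.
Qed.

End Gap.

(** The hypothesis of [gap_certificate] for [k = al * u], with the optimal
    [th = l / (u + n)] for [n <= 2] in-neighbours and [th = 3 / 5] for more. The constants
    [al] and [u] below are close to those that maximize [gam], for which the
    conditions for one and for two in-neighbours are the tight ones. *)
Definition cert_window (R : realFieldType) (l gam al u : R) : Prop :=
  [/\ 0 <= (l + 1) * (1 - l - gam) - al * u + al * l ^+ 2,
      0 <= (l + 2) * (2 - l - gam) - al - al * u + al * u * l ^+ 2 / (u + 1),
      0 <= (l + 3) * (3 - l - gam) - al * 2 - al * u + al * u * l ^+ 2 / (u + 2) &
      forall m : R, 3 <= m -> 0 <= (l + 1 + m) * (1 + m - l - gam) - al * m - al * u
          + al * u * (2 * (3 / 5) * l - (3 / 5) ^+ 2 * (u + m))].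

Fact window_25th (R : realFieldType) (l : R) : 17 / 8 <= l <= 12 / 5 ->
  cert_window l (25^-1) (14 / 5) (8 / 7).
Proof.
move=> /andP[h h'].
have p1 : 0 <= (l - 17 / 8) * (12 / 5 - l) by apply: mulr_ge0; lra.
have p2 := sqr_ge0 (l - 17 / 8).
have p3 := sqr_ge0 (l - 12 / 5).
split=> [||| m hm].
- by lra.
- by rewrite (_ : 8 / 7 + 1 = 15 / 7); lra.
- by rewrite (_ : 8 / 7 + 2 = 22 / 7); lra.
by have := sqr_ge0 (m - 3); lra.
Qed.

Fact window_16th (R : realFieldType) (l : R) : 24 / 11 <= l <= 5 / 2 ->
  cert_window l (16^-1) (8 / 3) (5 / 4).
Proof.
move=> /andP[h h'].
have p1 : 0 <= (l - 24 / 11) * (5 / 2 - l) by apply: mulr_ge0; lra.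
have p2 := sqr_ge0 (l - 24 / 11).
have p3 := sqr_ge0 (l - 5 / 2).
split=> [||| m hm].
- by lra.
- by rewrite (_ : 5 / 4 + 1 = 9 / 4); lra.
- by rewrite (_ : 5 / 4 + 2 = 13 / 4); lra.
by have := sqr_ge0 (m - 3); lra.
Qed.

Fact window_2_25ths (R : realFieldType) (l : R) : 38 / 17 <= l <= 18 / 7 ->
  cert_window l (2 / 25) (8 / 3) (5 / 4).
Proof.
move=> /andP[h h'].
have p1 : 0 <= (l - 38 / 17) * (18 / 7 - l) by apply: mulr_ge0; lra.
have p2 := sqr_ge0 (l - 38 / 17).
have p3 := sqr_ge0 (l - 18 / 7).
split=> [||| m hm].
- by lra.
- by rewrite (_ : 5 / 4 + 1 = 9 / 4); lra.
- by rewrite (_ : 5 / 4 + 2 = 13 / 4); lra.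
by have := sqr_ge0 (m - 3); lra.
Qed.

Fact window_27_200ths (R : realFieldType) (l : R) : 5 / 2 <= l <= 11 / 4 ->
  cert_window l (27 / 200) (12 / 5) (3 / 2).
Proof.
move=> /andP[h h'].
have p1 : 0 <= (l - 5 / 2) * (11 / 4 - l) by apply: mulr_ge0; lra.
have p2 := sqr_ge0 (l - 5 / 2).
have p3 := sqr_ge0 (l - 11 / 4).
split=> [||| m hm].
- by lra.
- by rewrite (_ : 3 / 2 + 1 = 5 / 2); lra.
- by rewrite (_ : 3 / 2 + 2 = 7 / 2); lra.
by have := sqr_ge0 (m - 3); lra.
Qed.

Section GapWindows.
Variables (R : realType) (G : sgraph) (C : {set {set G}}) (o : orientation C).
Variable e0 : line_graph G.
Local Notation rho := (lambda_max R (line_graph G) + 2).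
Variables (x : G -> R) (l : R) (v0 : G).
Hypotheses (x0 : x v0 != 0) (hx : forall v, nbr_sum x v = l * x v) (l0 : 0 <= l).

Lemma gap_window (gam al u : R) : 0 < al -> 0 < u -> cert_window l gam al u ->
  gam <= rho - 2 * l.
Proof.
move=> al0 u0 [h0 h1 h2 h3].
have ku : al * u / al = u by rewrite mulrAC divff ?mul1r // gt_eqF.
apply: (gap_certificate o e0 x0 hx l0 al0 (ltW (mulr_gt0 al0 u0))); rewrite ku.
have th0 (n : R) : 0 <= n -> 2 * (l / (u + n)) * l - (l / (u + n)) ^+ 2 * (u + n) = l ^+ 2 / (u + n).
  by move=> n0; field; rewrite gt_eqF // ltr_wpDr.
case=> [|[|[|n]]].
- exists (l / u); move: h0; rewrite mulr0 subr0 !addr0.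
  suff -> : al * u * (2 * (l / u) * l - (l / u) ^+ 2 * u) = al * l ^+ 2 by [].
  by field; rewrite gt_eqF.
- by exists (l / (u + 1)); rewrite th0 // mulrA; move: h1; move: (_ / (u + 1)) => t; lra.
- by exists (l / (u + 2)); rewrite th0 // mulrA; move: h2; move: (_ / (u + 2)) => t; lra.
exists (3 / 5); apply: h3; by rewrite ler_nat.
Qed.

(** In each of the next four lemmas, a small [l] leaves the gap to the bound on [rho], an
    intermediate one to a certificate and a large one to [gap_square]. *)
Lemma gap_25th : 43 / 10 <= rho -> 25^-1 <= rho - 2 * l.
Proof.
move=> hr; have [h|h] := leP l (17 / 8); first by lra.
have [h'|h'] := leP l (12 / 5).
  apply: gap_window (window_25th _); last by rewrite (ltW h).
  by lra.
  by lra.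
have p : 0 <= (l - 12 / 5) * (l - 2) by apply: mulr_ge0; lra.
by have := gap_square o e0 x0 hx; lra.
Qed.

Lemma gap_16th : 31 / 7 <= rho -> 16^-1 <= rho - 2 * l.
Proof.
move=> hr; have [h|h] := leP l (24 / 11); first by lra.
have [h'|h'] := leP l (5 / 2).
  apply: gap_window (window_16th _); last by rewrite (ltW h).
  by lra.
  by lra.
have p : 0 <= (l - 5 / 2) * (l - 2) by apply: mulr_ge0; lra.
by have := gap_square o e0 x0 hx; lra.
Qed.

Lemma gap_2_25ths : 41 / 9 <= rho -> 2 / 25 <= rho - 2 * l.
Proof.
move=> hr; have [h|h] := leP l (38 / 17); first by lra.
have [h'|h'] := leP l (18 / 7).
  apply: gap_window (window_2_25ths _); last by rewrite (ltW h).
  by lra.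
  by lra.
have p : 0 <= (l - 18 / 7) * (l - 2) by apply: mulr_ge0; lra.
by have := gap_square o e0 x0 hx; lra.
Qed.

Lemma gap_27_200ths : 26 / 5 <= rho -> 27 / 200 <= rho - 2 * l.
Proof.
move=> hr; have [h|h] := leP l (5 / 2); first by lra.
have [h'|h'] := leP l (11 / 4).
  apply: gap_window (window_27_200ths _); last by rewrite (ltW h).
  by lra.
  by lra.
have p : 0 <= (l - 11 / 4) * (l - 2) by apply: mulr_ge0; lra.
by have := gap_square o e0 x0 hx; lra.
Qed.

End GapWindows.

(** * A lower bound for 1 - cos (pi / K) *)

Section CosineBound.
Import numFieldNormedType.Exports.
Variable R : realType.
Implicit Types (x : R) (f df : R -> R).

Lemma ge0_from_derive f df : f 0 = 0 -> (forall x, is_derive x 1 f (df x)) ->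
  (forall x, 0 <= x -> 0 <= df x) -> forall x, 0 <= x -> 0 <= f x.
Proof.
move=> f0 hf hdf x; rewrite le_eqVlt => /predU1P[<-|x0]; first by rewrite f0.
have cf : {within `[0, x], continuous f}%classic.
  by apply: derivable_within_continuous => y _; have [] := hf y.
have [c] := MVT x0 (fun y _ => hf y) cf.
rewrite in_itv /= => /andP[c0 _]; rewrite f0 !subr0 => ->.
by rewrite mulr_ge0 ?hdf // ltW.
Qed.

Lemma sin_le x : 0 <= x -> sin x <= x.
Proof.
move=> x0; rewrite -subr_ge0.
apply: (@ge0_from_derive (fun y => y - sin y) (fun y => 1 - cos y)) _ _ _ _ x0.
- by rewrite sin0 subr0.
- by move=> y _; rewrite subr_ge0 cos_le1.
Qed.

Lemma cos_ge x : 0 <= x -> 1 - x ^+ 2 / 2 <= cos x.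
Proof.
move=> x0; rewrite -subr_ge0.
apply: (@ge0_from_derive (fun y => cos y - (1 - y ^+ 2 / 2)) (fun y => y - sin y)) _ _ _ _ x0.
- by rewrite cos0; lra.
- move=> y; apply: is_derive_eq; rewrite /GRing.scale /=; lra.
- by move=> y y0; rewrite subr_ge0 sin_le.
Qed.

Lemma sin_ge x : 0 <= x -> x - x ^+ 3 / 6 <= sin x.
Proof.
move=> x0; rewrite -subr_ge0.
apply: (@ge0_from_derive (fun y => sin y - (y - y ^+ 3 / 6)) (fun y => cos y - (1 - y ^+ 2 / 2))) _ _ _ _ x0.
- by rewrite sin0; lra.
- move=> y; apply: is_derive_eq; rewrite /GRing.scale /=; lra.
- by move=> y y0; rewrite subr_ge0 cos_ge.
Qed.

Lemma cos_le x : 0 <= x -> cos x <= 1 - x ^+ 2 / 2 + x ^+ 4 / 24.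
Proof.
move=> x0; rewrite -subr_ge0.
apply: (@ge0_from_derive (fun y => 1 - y ^+ 2 / 2 + y ^+ 4 / 24 - cos y)
  (fun y => sin y - (y - y ^+ 3 / 6))) _ _ _ _ x0.
- by rewrite cos0; lra.
- move=> y; apply: is_derive_eq; rewrite /GRing.scale /=; lra.
- by move=> y y0; rewrite subr_ge0 sin_ge.
Qed.

Lemma sin_pi6 : sin (pi / 6) = 1 / 2 :> R.
Proof.
set y : R := pi / 6; have p0 := pi_gt0 R.
have s0 : 0 < sin y by apply: sin_gt0_pi; rewrite /y; lra.
have : sin (y *+ 2 + y) = 1.
  by rewrite -(sin_pihalf R); congr sin; rewrite /y mulr2n; field.
rewrite sinD sin_mulr2n cos_mulr2n mulr2n => h.
have h2 := cos2sin2 y.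
have : (sin y + 1) * (2 * sin y - 1) ^+ 2 = 0.
  move: h h2; set s := sin y; set c := cos y => h h2.
  have : (c * s + c * s) * c + (c ^+ 2 *+ 2 - 1) * s = 3 * s - 4 * s ^+ 3.
    transitivity (4 * c ^+ 2 * s - s); first by rewrite mulr2n; ring.
    by rewrite h2; ring.
  by rewrite h => e; transitivity (4 * s ^+ 3 - 3 * s + 1); [ring|lra].
move=> /eqP; rewrite mulf_eq0 sqrf_eq0 => /orP[]/eqP e; lra.
Qed.

(** From [1 - (pi / 6)^2 / 2 <= cos (pi / 6) <= 13 / 15], where the square of the
    cosine is [3 / 4]. *)
Lemma pi_sqr_ge : 48 / 5 <= (pi : R) ^+ 2.
Proof.
have p0 := pi_gt0 R.
have x0 : 0 <= pi / 6 :> R by lra.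
have h := cos_ge x0; have h2 := cos2sin2 (pi / 6 : R); rewrite sin_pi6 in h2.
have : cos (pi / 6 : R) <= 13 / 15.
  rewrite leNgt; apply/negP => c; have : (13 / 15) ^+ 2 < cos (pi / 6 : R) ^+ 2.
    by rewrite ltr_pXn2r // nnegrE; lra.
  by rewrite h2; lra.
move=> h3; have : 1 - (pi / 6) ^+ 2 / 2 <= 13 / 15 :> R by exact: le_trans h h3.
lra.
Qed.

Lemma cos_pi_div_le (K : R) : 2 <= K ->
  24 / 5 / K ^+ 2 - 96 / 25 / K ^+ 4 <= 1 - cos (pi / K).
Proof.
move=> K2; have p0 := pi_gt0 R; have K0 : 0 < K by lra.
have x0 : 0 <= pi / K by rewrite divr_ge0 // ltW.
have := cos_le x0; set t := (pi / K) ^+ 2.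
have -> : (pi / K) ^+ 4 = t ^+ 2 by rewrite /t -exprM.
set s := 48 / 5 / K ^+ 2.
have -> : 24 / 5 / K ^+ 2 - 96 / 25 / K ^+ 4 = s / 2 - s ^+ 2 / 24.
  by rewrite /s; field; rewrite gt_eqF.
have Ki : 0 <= (K ^+ 2)^-1 by rewrite invr_ge0 sqr_ge0.
have st : s <= t by rewrite /s /t expr_div_n ler_wpM2r // pi_sqr_ge.
have t6 : t <= 4.
  have -> : 4 = 2 ^+ 2 :> R by ring.
  rewrite /t ler_pXn2r ?nnegrE //.
  by rewrite ler_pdivrMr //; have := pihalf_lt2 R; lra.
have s0 : 0 <= s by rewrite /s; apply: mulr_ge0 => //; lra.
(* [t / 2 - t ^ 2 / 24] increases up to [t = 6]. *)
have : 0 <= (t - s) * (12 - t - s) by apply: mulr_ge0; lra.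
lra.
Qed.

End CosineBound.

(** * Numerical inequalities *)

Section Numerics.
Variable R : realFieldType.
Implicit Types (K l t : R).

(** The Taylor polynomial of [1 - cos (pi / K)], with [pi ^ 2] replaced by [48 / 5]. *)
Definition delta_low K : R := 24 / 5 / K ^+ 2 - 96 / 25 / K ^+ 4.

Lemma delta_low_quot (c A B C K : R) : 0 < K ->
  0 <= (c * K ^+ 4 + 24 / 5 * K ^+ 2 - 96 / 25) * (B + K) - (A + C * K) * K ^+ 4 ->
  A + C * K <= (c + delta_low K) * (B + K).
Proof.
move=> K0 h; rewrite -subr_ge0.
have K4 : 0 < K ^+ 4 by rewrite exprn_gt0.
rewrite -(pmulr_lge0 _ K4).
suff -> : ((c + delta_low K) * (B + K) - (A + C * K)) * K ^+ 4
  = (c * K ^+ 4 + 24 / 5 * K ^+ 2 - 96 / 25) * (B + K) - (A + C * K) * K ^+ 4 by [].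
by rewrite /delta_low; field; rewrite gt_eqF.
Qed.

Lemma delta_low_ge0 K : 1 <= K -> 0 <= delta_low K.
Proof.
move=> K1; have K0 : 0 < K by lra.
rewrite /delta_low (_ : _ - _ = (24 / 5 * K ^+ 2 - 96 / 25) / K ^+ 4); last by field; rewrite gt_eqF.
apply: divr_ge0; last by rewrite exprn_ge0 // ltW.
have : 0 <= (K - 1) * (K + 1) by apply: mulr_ge0; lra.
lra.
Qed.

(** The quotient [(A + c n) / (B + n)] of a test vector with [n] tree vertices decreases in
    [n] as long as it exceeds [c]. So a tree with more than [h] vertices besides its root
    does no harm. *)
Lemma quotient_bound (s A B c gam d h n m : R) : 0 <= c <= gam -> 0 <= d -> 0 < B ->
  0 <= h <= n -> m <= n -> A + c * h <= (gam + d) * (B + h) ->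
  s * (B + n) <= A + m * c -> s <= gam + d.
Proof.
move=> /andP[c0 cg] d0 B0 /andP[h0 hn] mn h1 h2.
have p1 : 0 <= (gam + d - c) * (n - h) by apply: mulr_ge0; lra.
have p2 : 0 <= c * (n - m) by apply: mulr_ge0; lra.
have Bn : 0 < B + n by lra.
rewrite -(ler_pM2r Bn); lra.
Qed.

Fact broom_slope : (0 : R) <= (64 / 625 : R) <= (27 / 200 : R).
Proof. by apply/andP; split; lra. Qed.

Fact pentagon_slope : (0 : R) <= (1 / 25 : R) <= (16^-1 : R).
Proof. by apply/andP; split; lra. Qed.

Fact half_girth_ge1 (a : R) : 7 <= a -> 1 <= (a + 3) / 2.
Proof. by move=> ?; lra. Qed.

Lemma num_triangle_broom (h : R) : 2 <= h ->
  3099 / 5000 + 64 / 625 * h <= (27 / 200 + delta_low (3 + h)) * (2937 / 5000 + h).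
Proof.
move=> h1; have [K K5 ->] : exists2 K, 5 <= K & h = K - 3 by exists (3 + h); lra.
rewrite [3 + _]addrC subrK; have K0 : 0 < K by lra.
have := @delta_low_quot (27 / 200) (3099 / 5000 - 64 / 625 * 3) (2937 / 5000 - 3) (64 / 625) K K0.
suff p : 0 <= (27 / 200 * K ^+ 4 + 24 / 5 * K ^+ 2 - 96 / 25) * (2937 / 5000 - 3 + K)
   - (3099 / 5000 - 64 / 625 * 3 + 64 / 625 * K) * K ^+ 4 by move=> /(_ p); lra.
(* Expanded at its smallest value, the polynomial has nonnegative coefficients. *)
have [t t0 ->] : exists2 t, 0 <= t & K = 5 + t by exists (K - 5); lra.
have := exprn_ge0 2 t0; have := exprn_ge0 3 t0; have := exprn_ge0 4 t0; have := exprn_ge0 5 t0.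
lra.
Qed.

Lemma num_triangle_path (h : R) : 2 <= h ->
  59 / 100 <= (2 / 25 + delta_low (3 + h)) * (33 / 100 + h).
Proof.
move=> h1; have [K K5 ->] : exists2 K, 5 <= K & h = K - 3 by exists (3 + h); lra.
rewrite [3 + _]addrC subrK; have K0 : 0 < K by lra.
have := @delta_low_quot (2 / 25) (59 / 100) (33 / 100 - 3) 0 K K0.
suff p : 0 <= (2 / 25 * K ^+ 4 + 24 / 5 * K ^+ 2 - 96 / 25) * (33 / 100 - 3 + K)
   - (59 / 100 + 0 * K) * K ^+ 4 by move=> /(_ p); lra.
have [t t0 ->] : exists2 t, 0 <= t & K = 5 + t by exists (K - 5); lra.
have := exprn_ge0 2 t0; have := exprn_ge0 3 t0; have := exprn_ge0 4 t0; have := exprn_ge0 5 t0.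
lra.
Qed.

Lemma num_pentagon (h : R) : 1 <= h ->
  2707 / 5000 + 1 / 25 * h <= (16^-1 + delta_low (4 + h)) * (689 / 500 + h).
Proof.
move=> h1; have [K K5 ->] : exists2 K, 5 <= K & h = K - 4 by exists (4 + h); lra.
rewrite [4 + _]addrC subrK; have K0 : 0 < K by lra.
have := @delta_low_quot (1 / 16) (2707 / 5000 - 1 / 25 * 4) (689 / 500 - 4) (1 / 25) K K0.
suff p : 0 <= (1 / 16 * K ^+ 4 + 24 / 5 * K ^+ 2 - 96 / 25) * (689 / 500 - 4 + K)
   - (2707 / 5000 - 1 / 25 * 4 + 1 / 25 * K) * K ^+ 4 by move=> /(_ p); lra.
have [t t0 ->] : exists2 t, 0 <= t & K = 5 + t by exists (K - 5); lra.
(* The coefficient of [t ^ 3] is negative; the square compensates for it. *)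
have := exprn_ge0 5 t0; have := exprn_ge0 4 t0; have := sqr_ge0 (t * (t - 14)).
have := exprn_ge0 2 t0; lra.
Qed.

(** Multiplied by [3 g K ^ 2] and expanded at [g = 7], [h = 1], the difference is a polynomial
    with nonnegative coefficients once [delta_low] is replaced by a multiple of
    [1 / K ^ 2]. *)
Lemma num_long_cycle (g h : R) : 7 <= g -> 1 <= h ->
  4 / g <= (1 / 25 + delta_low ((g + 3) / 2 + h)) * (g / 3 + 2 / (3 * g) + h).
Proof.
move=> g7 h1; set K := (g + 3) / 2 + h.
have K6 : 6 <= K by rewrite /K; lra.
have K0 : 0 < K by lra.
have K2 : 0 < K ^+ 2 by rewrite exprn_gt0.
have dl : 187 / 40 / K ^+ 2 <= delta_low K.
  rewrite -subr_ge0 /delta_low.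
  have -> : 24 / 5 / K ^+ 2 - 96 / 25 / K ^+ 4 - 187 / 40 / K ^+ 2
     = (1 / 8 * K ^+ 2 - 96 / 25) / K ^+ 4 by field; rewrite gt_eqF.
  have : 0 <= (K - 6) * (K + 6) by apply: mulr_ge0; lra.
  by move=> ?; apply: divr_ge0; [lra|rewrite exprn_ge0 // ltW].
pose F := g ^+ 2 + 2 + 3 * g * h.
have -> : g / 3 + 2 / (3 * g) + h = F / (3 * g) by rewrite /F; field; lra.
have g0 : 0 < g by lra.
have F0 : 0 <= F.
  by have := mulr_ge0 (ltW g0) (le_trans ler01 h1); have := sqr_ge0 g; rewrite /F; lra.
have : (1 / 25 + 187 / 40 / K ^+ 2) * (F / (3 * g)) <= (1 / 25 + delta_low K) * (F / (3 * g)).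
  by rewrite ler_wpM2r ?lerD2l // divr_ge0 // mulr_ge0 // ltW.
apply: le_trans; rewrite -subr_ge0.
have -> : (1 / 25 + 187 / 40 / K ^+ 2) * (F / (3 * g)) - 4 / g
   = ((1 / 25 * K ^+ 2 + 187 / 40) * F - 12 * K ^+ 2) / (3 * g * K ^+ 2).
  by field; rewrite !gt_eqF.
apply: divr_ge0; last by rewrite !mulr_ge0 // ltW.
rewrite /F /K.
have [a a0 ->] : exists2 a, 0 <= a & g = 7 + a by exists (g - 7); lra.
have [b b0 ->] : exists2 b, 0 <= b & h = 1 + b by exists (h - 1); lra.
have p i j : 0 <= a ^+ i * b ^+ j by rewrite mulr_ge0 ?exprn_ge0.
have := p 0%N 1%N; have := p 0%N 2; have := p 0%N 3; have := p 1%N 0%N; have := p 1%N 1%N.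
have := p 1%N 2; have := p 1%N 3; have := p 2 0%N; have := p 2 1%N; have := p 2 2.
have := p 3 0%N; have := p 3 1%N; have := p 4 0%N.
rewrite !expr0 !expr1 !mul1r !mulr1; lra.
Qed.

(** Solving for [a], [b], [d] and adding up shows that [a + b + d] is a proper fraction of
    itself. *)
Lemma triangle_system_trivial (l a b d pa pb pd : R) : 0 < pa -> 0 < pb -> 0 < pd ->
  l * (pb * pd + pa * pd + pa * pb) < pa * pb * pd ->
  pa * a = l * (a + b + d) -> pb * b = l * (a + b + d) -> pd * d = l * (a + b + d) ->
  [/\ a = 0, b = 0 & d = 0].
Proof.
move=> a0 b0 d0 hF ha hb hd.
have : (pa * pb * pd - l * (pb * pd + pa * pd + pa * pb)) * (a + b + d) = 0.
  transitivity (pb * pd * (pa * a) + pa * pd * (pb * b) + pa * pb * (pd * d)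
    - l * (pb * pd + pa * pd + pa * pb) * (a + b + d)); first by ring.
  by rewrite ha hb hd; ring.
move=> /eqP; rewrite mulf_eq0 subr_eq0 gt_eqF //= => /eqP X0.
rewrite X0 mulr0 in ha hb hd.
have z p y : 0 < p -> p * y = 0 -> y = 0.
  by move=> p0 /eqP; rewrite mulf_eq0 gt_eqF //= => /eqP.
by split; [exact: z ha|exact: z hb|exact: z hd].
Qed.

Lemma num_one_leaf (l p : R) : p = l ^+ 2 + l -> 24 / 11 < l ->
  l * (p * p + (p - 1) * p + (p - 1) * p) < (p - 1) * p * p.
Proof.
move=> hp hl; have p0 : 0 < p by rewrite hp; have := sqr_ge0 l; lra.
have : 0 < p * (p - 1) - l * (3 * p - 2).
  rewrite {p p0}hp; have [t t0 ->] : exists2 t, 0 < t & l = 24 / 11 + t by exists (l - 24 / 11); lra.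
  have := exprn_gt0 2 t0; have := exprn_gt0 3 t0; have := exprn_gt0 4 t0; lra.
move=> /(mulr_gt0 p0); lra.
Qed.

Lemma num_two_leaves (l p : R) : p = l ^+ 2 + l -> 7 / 3 < l ->
  l * ((p - 1) * p + (p - 1) * p + (p - 1) * (p - 1)) < (p - 1) * (p - 1) * p.
Proof.
move=> hp hl; have p0 : 0 < p - 1 by rewrite hp; have := sqr_ge0 l; lra.
have : 0 < p * (p - 1) - l * (3 * p - 1).
  rewrite {p p0}hp; have [t t0 ->] : exists2 t, 0 < t & l = 7 / 3 + t by exists (l - 7 / 3); lra.
  have := exprn_gt0 2 t0; have := exprn_gt0 3 t0; have := exprn_gt0 4 t0; lra.
move=> /(mulr_gt0 p0); lra.
Qed.

Lemma num_three_leaves (l p : R) : p = l ^+ 2 + l -> 5 / 2 < l ->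
  l * ((p - 1) * (p - 1) + (p - 1) * (p - 1) + (p - 1) * (p - 1)) < (p - 1) * (p - 1) * (p - 1).
Proof.
move=> hp hl; have p0 : 0 < p - 1 by rewrite hp; have := sqr_ge0 l; lra.
have : 0 < p - 1 - 3 * l.
  have q : 0 < (l - 5 / 2) * (l - 5 / 2) by apply: mulr_gt0; lra.
  by rewrite hp; lra.
move=> /(mulr_gt0 (mulr_gt0 p0 p0)); lra.
Qed.

(** [kb] and [kd] tell whether the second and the third vertex of the triangle carry a
    leaf, like the first; [a], [b] and [d] are the values of an eigenvector. Their
    equations bound [l] by [24 / 11], [7 / 3] or [5 / 2] for one, two or three leaves. *)
Lemma triangle_leaves_gap (r l a b d kb kd : R) :
  kb = 0 \/ kb = 1 -> kd = 0 \/ kd = 1 -> (0 < l -> ~ [/\ a = 0, b = 0 & d = 0]) ->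
  l ^+ 2 * a = l * (b + d) + a -> l ^+ 2 * b = l * (d + a) + kb * b ->
  l ^+ 2 * d = l * (a + b) + kd * d ->
  (7 + kb) ^+ 2 + (6 + kb + kd) ^+ 2 + (7 + kd) ^+ 2 + 25 + kb * (4 + kb) ^+ 2 + kd * (4 + kd) ^+ 2
    <= r * (17 + (3 + kb) ^+ 2 + (3 + kd) ^+ 2 + kb + kd) ->
  4 / 25 <= r - 2 * l.
Proof.
move=> hkb hkd nz ha hb hd; pose p := l ^+ 2 + l.
have ha' : (p - 1) * a = l * (a + b + d) by rewrite /p; lra.
have hb' : (p - kb) * b = l * (a + b + d) by rewrite /p; lra.
have hd' : (p - kd) * d = l * (a + b + d) by rewrite /p; lra.
have absurd : 2 <= l -> ~ (l * ((p - kb) * (p - kd) + (p - 1) * (p - kd) + (p - 1) * (p - kb))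
    < (p - 1) * (p - kb) * (p - kd)).
  move=> l2 hF; have p1 : 1 < p by rewrite /p; have := sqr_ge0 l; lra.
  have pk k : k = 0 \/ k = 1 -> 0 < p - k by case=> ->; lra.
  apply: nz; first by lra.
  by apply: (triangle_system_trivial _ (pk _ hkb) (pk _ hkd) hF); rewrite ?subr_gt0.
have tF := num_one_leaf (erefl p); have tF2 := num_two_leaves (erefl p).
have tF3 := num_three_leaves (erefl p).
move: absurd {hb hd hb' hd' ha ha' nz}; case: hkb => ->; case: hkd => -> absurd test.
- have [hl|hl] := leP l (24 / 11); first by lra.
  by case: absurd; [lra|rewrite !subr0; apply: le_lt_trans (tF hl); lra].
- have [hl|hl] := leP l (7 / 3); first by lra.
  by case: absurd; [lra|have := tF2 hl; lra].
- have [hl|hl] := leP l (7 / 3); first by lra.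
  by case: absurd; [lra|have := tF2 hl; lra].
have [hl|hl] := leP l (5 / 2); first by lra.
by case: absurd; [lra|have := tF3 hl; lra].
Qed.

Fact leaf_slope : (0 : R) <= 0 <= (4 / 25 : R).
Proof. by apply/andP; split; lra. Qed.

Fact num_triangle_leaf : 773 / 1250 + 0 * 1 <= (4 / 25 + delta_low 4) * (513 / 1250 + 1).
Proof.
have := @delta_low_quot (4 / 25) (773 / 1250) (513 / 1250 - 3) 0 4 _; lra.
Qed.

End Numerics.

(** * Test vectors for the various girths *)

Section CycleLengths.
Variables (R : realType) (G : sgraph) (C : {set {set G}}) (o : orientation C).
Variable e0 : line_graph G.
Hypothesis godd : odd #|C|.
Local Notation cyc := (cyc o).
Local Notation par := (par o).
Local Notation g := (size cyc).
Local Notation rho := (lambda_max R (line_graph G) + 2).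
Local Notation sigma := (lambda_min R (line_graph G) + 2).
Variables (w : G) (w0 : index w cyc = 0%N).
Local Notation N := (#|tree o w|%:R : R).
Local Notation N1 := (#|kids o w|%:R : R).

Lemma base_in_cyc : w \in cyc.
Proof. by rewrite -index_mem w0 cyc_gt0. Qed.

Lemma rho_test_base (phi : nat -> R) (p : R) :
  cyc_sum o phi + N1 * (phi 0%N + p) ^+ 2
  <= rho * (\sum_(0 <= i < g) phi i ^+ 2 + N1 * p ^+ 2).
Proof.
pose psi i : R := if i == 0%N then p else 0.
have wc := base_in_cyc.
have idx v : v \in cyc -> v != w -> psi (index v cyc) = 0.
  move=> vc vw; rewrite /psi; case: eqP => // e; case/eqP: vw.
  by rewrite -(nth_index v vc) e -w0 nth_index.
have pw : psi (index w cyc) = p by rewrite w0.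
have := rho_test o e0 phi psi.
rewrite [X in _ <= rho * (_ + X)](bigD1 w) //= [X in _ <= rho * (_ + (_ + X))]big1; last first.
  by move=> v /andP[vc vw]; rewrite idx // expr0n mulr0.
rewrite addr0 pw; apply: le_trans; rewrite lerD2l (bigD1 w) //= pw w0 lerDl.
by apply: sumr_ge0 => v _; rewrite mulr_ge0 // sqr_ge0.
Qed.

Lemma kids_gt0 : (0 < #|tree o w|)%N -> (0 < #|kids o w|)%N.
Proof.
move=> /card_gt0P[v]; have [k] := ubnP (dep o v); elim: k v => // k IH v.
rewrite ltnS inE => dk /andP[vc /eqP av].
have [pc|pc] := boolP (par v \in cyc).
  by apply/card_gt0P; exists v; rewrite inE vc -av -(anchor_par vc) anchor_cyc /=.
by apply: (IH (par v)); rewrite ?inE ?pc ?anchor_par ?av //= -ltnS -(dep_par vc) ltnS.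
Qed.

Lemma kids_le_tree : N1 <= N.
Proof. by rewrite ler_nat; apply: subset_leq_card; apply: kids_tree base_in_cyc. Qed.

Section Triangle.
Hypothesis g3 : g = 3%N.

Let f3 (a b : R) (i : nat) : R := nth 0 [:: a; b; - b] i.

Lemma triangle_alt (a b : R) : alt_sum o (f3 a b) = 2 * (a - b) ^+ 2 + 4 * b ^+ 2.
Proof. by rewrite /alt_sum g3 /f3 /= !big_nat_recr //= big_geq //=; ring. Qed.

Lemma triangle_sqr (a b : R) : \sum_(0 <= i < g) f3 a b i ^+ 2 = a ^+ 2 + 2 * b ^+ 2.
Proof. by rewrite g3 /f3 !big_nat_recr //= big_geq //=; ring. Qed.

Lemma sigma_triangle (a b t : R) :
  sigma * (a ^+ 2 + 2 * b ^+ 2 + N * t ^+ 2) <= 2 * (a - b) ^+ 2 + 4 * b ^+ 2 + N1 * (t - a) ^+ 2.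
Proof.
by have := sigma_test e0 godd (f3 a b) t w0; rewrite triangle_alt triangle_sqr.
Qed.

Lemma rho_triangle (a b p : R) :
  2 * (a + b) ^+ 2 + 4 * b ^+ 2 + N1 * (a + p) ^+ 2 <= rho * (a ^+ 2 + 2 * b ^+ 2 + N1 * p ^+ 2).
Proof.
have := rho_test_base (fun i => nth 0 [:: a; b; b] i) p.
rewrite /cyc_sum g3 /= !big_nat_recr //= !big_geq //=; lra.
Qed.

End Triangle.

Section Pentagon.
Hypothesis g5 : g = 5%N.

Lemma sigma_pentagon (a b d t : R) :
  sigma * (a ^+ 2 + 2 * b ^+ 2 + 2 * d ^+ 2 + N * t ^+ 2)
  <= 2 * (a - b) ^+ 2 + 2 * (b - d) ^+ 2 + 4 * d ^+ 2 + N1 * (t - a) ^+ 2.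
Proof.
have := sigma_test e0 godd (fun i => nth 0 [:: a; b; d; - d; - b] i) t w0.
rewrite /alt_sum g5 /= !big_nat_recr //= !big_geq //=; lra.
Qed.

Lemma rho_pentagon (a b d p : R) :
  2 * (a + b) ^+ 2 + 2 * (b + d) ^+ 2 + 4 * d ^+ 2 + N1 * (a + p) ^+ 2
  <= rho * (a ^+ 2 + 2 * b ^+ 2 + 2 * d ^+ 2 + N1 * p ^+ 2).
Proof.
have := rho_test_base (fun i => nth 0 [:: a; b; d; d; b] i) p.
rewrite /cyc_sum g5 /= !big_nat_recr //= !big_geq //=; lra.
Qed.

End Pentagon.

Section LongCycle.
Hypothesis g7 : (6 < g)%N.

Lemma sum_linear_profile (s : R) (n : nat) :
  \sum_(0 <= i < n) (1 - i%:R * s) ^+ 2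
  = n%:R - s * n%:R * (n%:R - 1) + s ^+ 2 * (n%:R - 1) * n%:R * (2 * n%:R - 1) / 6.
Proof.
elim: n => [|n IH]; first by rewrite big_geq //; lra.
by rewrite big_nat_recr //= IH -natr1; lra.
Qed.

(** The profile falls linearly from 1 at [w] to -1 after a full turn, so it vanishes opposite
    to [w], where the alternating signs clash. *)
Lemma sigma_long : sigma * (g%:R / 3 + 2 / (3 * g%:R) + N) <= 4 / g%:R.
Proof.
have gp : (0 : R) < g%:R by rewrite ltr0n cyc_gt0.
have gn : (g%:R : R) != 0 by rewrite gt_eqF.
have := sigma_test e0 godd (fun i => 1 - i%:R * (2 / g%:R) : R) 1 w0.
rewrite (sum_linear_profile (2 / g%:R) g) /= mul0r subr0 subrr expr0n mulr0 addr0 expr1n mulr1.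
have -> : g%:R - 2 / g%:R * g%:R * (g%:R - 1) + (2 / g%:R) ^+ 2 * (g%:R - 1) * g%:R * (2 * g%:R - 1) / 6
   = g%:R / 3 + 2 / (3 * g%:R) :> R by field.
suff -> : alt_sum o (fun i => 1 - i%:R * (2 / g%:R) : R) = 4 / g%:R :> R by [].
rewrite /alt_sum (eq_bigr (fun=> (2 / g%:R) ^+ 2)) => [|i _]; last by rewrite -natr1; congr (_ ^+ _); ring.
rewrite sumr_const_nat subn0 -[_ *+ g.-1]mulr_natl.
have -> : g.-1%:R = g%:R - 1 :> R by rewrite -[X in _ = X%:R - 1](prednK (cyc_gt0 o)) -natr1 addrK.
by field.
Qed.

Lemma rho_long : 538 + 144 * N1 <= rho * (149 + 9 * N1).
Proof.
have [k eg] : exists k, g = k.+4.+3 by exists (g - 7)%N; lia.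
pose phi i : R := if i == 0%N then 9 else if (i == 1%N) || (i == g.-1) then 5
  else if (i == 2) || (i == g.-2) then 3 else 0.
have phi0 i : 0 <= phi i by rewrite /phi; do ![case: ifP => _ //].
have e0' : phi 0%N = 9 by [].
have e1 : phi 1%N = 5 by [].
have e2 : phi 2 = 3 by rewrite /phi eg.
have e5 : phi k.+4.+2 = 5 by rewrite /phi eg /= eqxx.
have e4 : phi k.+4.+1 = 3 by rewrite /phi eg /= eqxx; case: eqP => //; lia.
have em i : (i < k.+2)%N -> phi i.+3 = 0.
  by move=> hi; rewrite /phi eg /= !eqSS; do ![case: eqP => [?|_]; first lia].
have := rho_test_base phi 3.
have -> : \sum_(0 <= i < g) phi i ^+ 2 = 149.
  rewrite eg; do 2!rewrite big_nat_recr //=; do 3!rewrite big_nat_recl //=; rewrite e0' e1 e2 e4 e5.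
  rewrite big_nat big1 => [|i /andP[_ hi]]; last by rewrite em // expr0n.
  by ring.
have h : 538 <= cyc_sum o phi.
  rewrite /cyc_sum eg /=; do 2!rewrite big_nat_recr //=; do 3!rewrite big_nat_recl //=; rewrite e0' e1 e2 e4 e5.
  set S := \sum_(_ <= _ < _) _.
  have : 0 <= S by apply: sumr_ge0 => i _; apply: sqr_ge0.
  have a1 := phi0 3; have a2 := phi0 k.+4.
  have : 9 <= (3 + phi 3) ^+ 2 by nra.
  have : 9 <= (phi k.+4 + 3) ^+ 2 by nra.
  by lra.
by rewrite e0'; lra.
Qed.

End LongCycle.

End CycleLengths.

(** * The smallest eigenvalue, girth by girth *)

Section GirthCases.
Variables (R : realType) (G : sgraph) (C : {set {set G}}) (o : orientation C).
Variable e0 : line_graph G.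
Hypothesis godd : odd #|C|.
Local Notation cyc := (cyc o).
Local Notation par := (par o).
Local Notation g := (size cyc).
Local Notation rho := (lambda_max R (line_graph G) + 2).
Local Notation sigma := (lambda_min R (line_graph G) + 2).
Local Notation h := (max_tree_diameter C).
Variables (x : G -> R) (l : R) (v0 : G).
Hypotheses (x0 : x v0 != 0) (hx : forall v, nbr_sum x v = l * x v) (l0 : 0 <= l).
Variables (w : G) (w0 : index w cyc = 0%N).
Hypotheses (h_tree : (h <= #|tree o w|)%N) (h_gt0 : (0 < h)%N).
Local Notation N := (#|tree o w|%:R : R).
Local Notation N1 := (#|kids o w|%:R : R).

Let hN : (h%:R : R) <= N.
Proof. by rewrite ler_nat. Qed.

Let N1N : N1 <= N.
Proof. exact: kids_le_tree. Qed.

Let N1_ge1 : 1 <= N1.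
Proof. by rewrite ler1n; apply: kids_gt0; apply: leq_trans h_tree. Qed.

Let h_ge0 : 0 <= (h%:R : R) <= N.
Proof. by rewrite ler0n hN. Qed.

Let delta_ge0 (a : R) : 1 <= a -> 0 <= delta_low (a + h%:R).
Proof. by move=> a1; apply: delta_low_ge0; rewrite ler_wpDr. Qed.

(** [w] has degree at least 4, so that [rho >= 26 / 5] and the gap is large; [17 / 25] and
    [1 / 4] nearly minimize the quotient for all [h >= 2] at once. *)
Lemma triangle_broom : g = 3%N -> (1 < h)%N -> (1 < #|kids o w|)%N ->
  sigma <= rho - 2 * l + delta_low (3 + h%:R).
Proof.
move=> g3 h2 k2.
have N12 : 2 <= N1 by rewrite ler_nat.
have h2' : (2 : R) <= h%:R by rewrite ler_nat.
have hrho : 26 / 5 <= rho.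
  have t := rho_triangle e0 w0 g3 (4 : R) 1 1.
  rewrite -(@ler_pM2r _ (18 + N1)); lra.
have gap := gap_27_200ths o e0 x0 hx l0 hrho.
have hs := sigma_triangle e0 godd w0 g3 (17 / 25 : R) (1 / 4) 1.
have e1 : (17 / 25) ^+ 2 + 2 * (1 / 4) ^+ 2 = 2937 / 5000 :> R by field.
have e2 : 2 * (17 / 25 - 1 / 4) ^+ 2 + 4 * (1 / 4) ^+ 2 = 3099 / 5000 :> R by field.
have e3 : (1 - 17 / 25) ^+ 2 = 64 / 625 :> R by field.
rewrite e1 e2 e3 expr1n mulr1 in hs.
apply: le_trans (lerD gap (lexx _)).
apply: quotient_bound h_ge0 N1N (num_triangle_broom h2') hs.
- exact: (broom_slope R).
- by apply: delta_ge0; rewrite ler1n.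
- by rewrite divr_gt0 ?ltr0n.
Qed.

(** Only one edge joins [w] to its tree. It can therefore carry a large jump of the
    test vector, from 1 to [1 / 2], which makes up for the smaller gap. *)
Lemma triangle_path : g = 3%N -> (1 < h)%N -> (#|kids o w| <= 1)%N ->
  sigma <= rho - 2 * l + delta_low (3 + h%:R).
Proof.
move=> g3 h2 k2.
have N11 : N1 = 1 by apply/eqP; rewrite eq_le N1_ge1 andbT lern1.
have h2' : (2 : R) <= h%:R by rewrite ler_nat.
have hrho : 41 / 9 <= rho.
  by have := rho_triangle e0 w0 g3 (3 : R) 2 1; rewrite N11; lra.
have gap := gap_2_25ths o e0 x0 hx l0 hrho.
have hs := sigma_triangle e0 godd w0 g3 (1 / 2 : R) (1 / 5) 1.
have e1 : (1 / 2) ^+ 2 + 2 * (1 / 5) ^+ 2 = 33 / 100 :> R by field.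
have e2 : 2 * (1 / 2 - 1 / 5) ^+ 2 + 4 * (1 / 5) ^+ 2 + 1 * (1 - 1 / 2) ^+ 2
  = 59 / 100 + N1 * 0 :> R by rewrite mulr0; field.
rewrite N11 e1 e2 expr1n mulr1 in hs.
apply: le_trans (lerD gap (lexx _)).
apply: quotient_bound h_ge0 N1N _ hs.
- by rewrite lexx divr_ge0.
- by apply: delta_ge0; rewrite ler1n.
- by rewrite divr_gt0 ?ltr0n.
- by rewrite mul0r addr0; apply: num_triangle_path.
Qed.

(** The jump from [4 / 5] at [w] to 1 on its tree costs [1 / 25] per edge, less than the
    gap [1 / 16], so the number of these edges does not matter. *)
Lemma pentagon_bound : g = 5%N -> sigma <= rho - 2 * l + delta_low (4 + h%:R).
Proof.
move=> g5.
have h1' : (1 : R) <= h%:R by rewrite ler1n.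
have hrho : 31 / 7 <= rho.
  have t := rho_pentagon e0 w0 g5 (9 : R) 5 3 3.
  have n1 := N1_ge1; rewrite -(@ler_pM2r _ (149 + 9 * N1)); lra.
have gap := gap_16th o e0 x0 hx l0 hrho.
have hs := sigma_pentagon e0 godd w0 g5 (4 / 5 : R) (57 / 100) (21 / 100) 1.
have e1 : (4 / 5) ^+ 2 + 2 * (57 / 100) ^+ 2 + 2 * (21 / 100) ^+ 2 = 689 / 500 :> R by field.
have e2 : 2 * (4 / 5 - 57 / 100) ^+ 2 + 2 * (57 / 100 - 21 / 100) ^+ 2 + 4 * (21 / 100) ^+ 2
  = 2707 / 5000 :> R by field.
have e3 : (1 - 4 / 5) ^+ 2 = 1 / 25 :> R by field.
rewrite e1 e2 e3 expr1n mulr1 in hs.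
apply: le_trans (lerD gap (lexx _)).
apply: quotient_bound h_ge0 N1N (num_pentagon h1') hs.
- exact: (pentagon_slope R).
- by apply: delta_ge0; rewrite ler1n.
- by rewrite divr_gt0 ?ltr0n.
Qed.

Lemma long_cycle_bound : (6 < g)%N ->
  sigma <= rho - 2 * l + delta_low ((g%:R + 3) / 2 + h%:R).
Proof.
move=> g7.
have h1' : (1 : R) <= h%:R by rewrite ler1n.
have g7' : (7 : R) <= g%:R by rewrite ler_nat.
have hrho : 43 / 10 <= rho.
  have t := rho_long R e0 godd w0 g7.
  have n1 := N1_ge1; rewrite -(@ler_pM2r _ (149 + 9 * N1)); lra.
have gap := gap_25th o e0 x0 hx l0 hrho.
have gi : 0 < (g%:R)^-1 :> R by rewrite invr_gt0 (lt_le_trans _ g7').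
have hs : sigma * (g%:R / 3 + 2 / (3 * g%:R) + N) <= 4 / g%:R + N1 * 0.
  by rewrite mulr0 addr0; apply: sigma_long.
have hnum := num_long_cycle g7' h1'.
apply: le_trans (lerD gap (lexx _)).
apply: quotient_bound h_ge0 N1N _ hs.
- by rewrite lexx invr_ge0 ler0n.
- by apply/delta_ge0/half_girth_ge1.
- by rewrite addr_gt0 // divr_gt0 // ?mulr_gt0 // -invr_gt0.
- by rewrite mul0r addr0 -[25^-1]mul1r.
Qed.

End GirthCases.

(** * Triangles with single leaves, and the conclusion *)

Lemma par_inj (G : sgraph) (C : {set {set G}}) (o : orientation C) :
  {in cyc o &, injective (par o)}.
Proof.
move=> u v uc vc; rewrite !par_cyc //.
exact: (can_inj (prev_next (cyc_uniq o))).
Qed.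

Section TriangleWithLeaves.
Variables (R : realType) (G : sgraph) (C : {set {set G}}) (o : orientation C).
Variable e0 : line_graph G.
Hypothesis godd : odd #|C|.
Local Notation cyc := (cyc o).
Local Notation par := (par o).
Local Notation rho := (lambda_max R (line_graph G) + 2).
Local Notation sigma := (lambda_min R (line_graph G) + 2).
Local Notation h := (max_tree_diameter C).
Variables (x : G -> R) (l : R) (v0 : G).
Hypotheses (x0 : x v0 != 0) (hx : forall v, nbr_sum x v = l * x v).
Variables (w : G) (w0 : index w cyc = 0%N).
Hypotheses (g3 : size cyc = 3%N) (h1 : h = 1%N) (h_tree : (h <= #|tree o w|)%N).

Lemma leaf_eigen u : u \notin cyc -> l * x u = x (par u).
Proof.
move=> uc; rewrite -hx (nbr_sum_par o) big1 ?addr0 // => t /eqP pt.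
have tc : t \notin cyc by apply: contraNN uc => /par_in; rewrite pt.
by have := tree_depth1 (o := o) _ tc; rewrite h1 pt (negbTE uc) => /(_ isT).
Qed.

Lemma cyc_eigen v p : v \in cyc -> p \in cyc -> par p = v ->
  l ^+ 2 * x v = l * (x (par v) + x p) + #|kids o v|%:R * x v.
Proof.
move=> vc pc pp; rewrite expr2 -mulrA -hx (nbr_sum_par o) (bigD1 p) /=; last by rewrite pp.
rewrite addrA mulrDr; congr (_ + _); rewrite big_distrr /=.
rewrite (eq_bigl (mem (kids o v))) => [|u]; last first.
  rewrite !inE; have [e|] := eqVneq (par u) v; last by rewrite andbF.
  rewrite andbT; have [uc|uc] := boolP (u \in cyc); last first.
    by apply/eqP => eu; rewrite eu pc in uc.
  by apply/negbTE; rewrite negbK; apply/eqP; apply: (par_inj uc pc); rewrite e pp.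
under eq_bigr => u uk.
  have : u \in kids o v by [].
  rewrite inE => /andP[uc /eqP pu]; rewrite (leaf_eigen uc) pu; over.
by rewrite sumr_const mulr_natl.
Qed.

(** For [h = 1] the graph is the triangle with one to three leaves at distinct vertices,
    and [l] is bounded by the eigenvector equations instead of a certificate, which
    would give too small a gap. *)
Lemma triangle_leaves : sigma <= rho - 2 * l + delta_low (3 + h%:R).
Proof.
have [b [d E]] : exists b d, cyc = [:: w; b; d].
  by case: cyc g3 w0 => [|a [|b [|d []]]] //= _; case: eqP => // -> _; exists b, d.
have U := cyc_uniq o; have pcy := @par_cyc _ _ o; rewrite E in U pcy.
move: U; rewrite /= !inE negb_or andbT => /andP[/andP[wb wd] bd].
have pw : par w = b by rewrite pcy ?inE ?eqxx //= eqxx.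
have pb : par b = d.
  by rewrite pcy ?inE ?eqxx ?orbT //= eq_sym (negbTE wb) eqxx.
have pd : par d = w.
  by rewrite pcy ?inE ?eqxx ?orbT //= [d == w]eq_sym (negbTE wd) [d == b]eq_sym (negbTE bd) eqxx.
have wc : w \in cyc by rewrite E !inE eqxx.
have bc : b \in cyc by rewrite E !inE eqxx orbT.
have dc : d \in cyc by rewrite E !inE eqxx !orbT.
have ib : index b cyc = 1%N by rewrite E /= (negbTE wb) eqxx.
have id : index d cyc = 2 by rewrite E /= (negbTE wd) (negbTE bd) eqxx.
have sum3 (F : G -> R) : \sum_(v in cyc) F v = F w + (F b + F d).
  rewrite -big_uniq ?cyc_uniq //= E !big_cons big_nil addr0 //.
have kle v : v \in cyc -> (#|kids o v| <= 1)%N by move=> vc; apply: kids_le1; rewrite ?h1.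
have kw : #|kids o w| = 1%N.
  by apply/eqP; rewrite eqn_leq kle //= kids_gt0 // (leq_trans _ h_tree) ?h1.
have Ew := cyc_eigen wc dc pd; have Eb := cyc_eigen bc wc pw; have Ed := cyc_eigen dc bc pb.
rewrite pw kw in Ew; rewrite pb in Eb; rewrite pd in Ed.
have nonzero : 0 < l -> ~ [/\ x w = 0, x b = 0 & x d = 0].
  move=> lp [xw xb xd]; have cz v : v \in cyc -> x v = 0.
    by rewrite E !inE => /or3P[]/eqP ->.
  move/eqP: x0; apply; have [/cz//|vc] := boolP (v0 \in cyc).
  have := leaf_eigen vc; rewrite (cz (par v0)).
    by move/eqP; rewrite mulf_eq0 gt_eqF //= => /eqP.
  by apply: tree_depth1 vc; rewrite h1.
(* Close to an eigenvector of [D + A] for each number of leaves. *)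
have test := rho_test o e0 (fun i => nth 0 [:: 4; 3 + #|kids o b|%:R; 3 + #|kids o d|%:R] i) (fun=> 1 : R).
rewrite !sum3 w0 ib id /cyc_sum g3 /= !big_nat_recr //= !big_geq //= kw in test.
(* [14 / 25] and [11 / 50] are close to the optimum, whose quotient is about 0.4384. *)
have hs := sigma_triangle e0 godd w0 g3 (14 / 25 : R) (11 / 50) 1.
have e1 : (14 / 25) ^+ 2 + 2 * (11 / 50) ^+ 2 = 513 / 1250 :> R by field.
have e2 : 2 * (14 / 25 - 11 / 50) ^+ 2 + 4 * (11 / 50) ^+ 2 + 1 * (1 - 14 / 25) ^+ 2
  = 773 / 1250 + #|kids o w|%:R * 0 :> R by rewrite mulr0; field.
rewrite e1 kw e2 expr1n mulr1 in hs.
have eq01 v : v \in cyc -> #|kids o v|%:R = 0 :> R \/ #|kids o v|%:R = 1 :> R.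
  by move=> /kle; case: #|_| => [|[|]] // _; [left|right].
have gap : 4 / 25 <= rho - 2 * l.
  rewrite mul1r in Ew.
  apply: (triangle_leaves_gap (eq01 _ bc) (eq01 _ dc) nonzero Ew Eb Ed).
  by move: test; move: (lambda_max _ _) (#|kids o b|%:R) (#|kids o d|%:R) => r kb kd; lra.
apply: le_trans (lerD gap (lexx _)).
rewrite h1.
have -> : 3 + 1%:R = 4 :> R by rewrite -natrD.
have hN : 0 <= (1 : R) <= (#|tree o w|%:R : R).
  by apply/andP; split; rewrite ?ler01 // ler1n -h1.
have N1N := kids_le_tree R w0.
apply: quotient_bound (leaf_slope R) _ _ hN N1N (num_triangle_leaf R) hs.
  by apply: delta_low_ge0; rewrite ler1n.
by rewrite divr_gt0 ?ltr0n.
Qed.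

End TriangleWithLeaves.

Section CycleGraph.
Variables (R : realType) (G : sgraph) (C : {set {set G}}) (o : orientation C).
Hypothesis all_cyc : forall v, v \in cyc o.

(** On a cycle all degrees are 2, so [D + A = 2 + A]. *)
Lemma qform_cycle (y : G -> R) :
  qform y = 2 * (\sum_v y v ^+ 2) + \sum_v y v * nbr_sum y v.
Proof.
have inj : injective (par o) by move=> u v; apply: par_inj.
have sumP : \sum_v y (par o v) ^+ 2 = \sum_v y v ^+ 2 by rewrite [RHS](reindex_inj inj).
have -> : \sum_v y v * nbr_sum y v = \sum_v (2 * (y v * y (par o v))).
  transitivity (\sum_v y v * y (par o v) + \sum_v y v * \sum_(u | par o u == v) y u).
    by rewrite -big_split /=; apply: eq_bigr => v _; rewrite (nbr_sum_par o) mulrDr.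
  by rewrite (sum_fibersM o) -big_split /=; apply: eq_bigr => v _; ring.
rewrite (qform_par o) mulr_natl mulr2n -{2}sumP -!big_split /=.
by apply: eq_bigr => v _; ring.
Qed.

End CycleGraph.

Theorem theorem11 (R : realType) (G : sgraph) (C : {set {set G}}) (g h D0 : nat)
    (hG : connected_unicyclic G) (hC : is_cycle C)
    (hg : g = #|C|) (hodd : odd g)
    (hh : h = max_tree_diameter C)
    (hD0 : D0 = ((g + 1) %/ 2 + h)%N)
    (hlam : lambda_min R G >= 1 - cos (pi / (D0 + 1)%:R) - lambda_max R G) :
  spread R G <= spread R (line_graph G).
Proof.
have [p1 _] := orientation_exists hG hC.
have [w wc1 hdiam] := largest_tree p1.
have [p w0] := orientation_rot wc1; move: p w0 => o w0.
have wc : w \in cyc o by rewrite -index_mem w0 cyc_gt0.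
have godd : odd #|C| by rewrite -hg.
have ew : [set w; par o w]%SET \in edges G by rewrite edge_set2 (adj_par o) eqxx.
pose e0 : line_graph G := exist (fun s : {set G} => s \in edges G) _ ew.
have [x [v0 [x0 hx xmax]]] := lambda_maxP R w.
set l := lambda_max R G in hx xmax hlam *.
rewrite /spread -/l.
have [hz|hpos] := posnP h.
  have allc : forall v, v \in cyc o by apply: no_tree; rewrite -hh.
  have [y [v1 [y0 hy _]]] := lambda_minP R w.
  have := qform_max e0 x; rewrite (qform_cycle allc) (form_eigen hx) -mulrDl.
  rewrite ler_pM2r ?(sum_sqr_gt0 x0) // => h1.
  have := qform_min e0 y (odd_cycle_rigid o godd); rewrite (qform_cycle allc) (form_eigen hy) -mulrDl.
  rewrite ler_pM2r ?(sum_sqr_gt0 y0) // => h2.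
  lra.
have htree : (h <= #|tree o w|)%N by rewrite hh hdiam diameter_rooted_tree.
have l0 : 0 <= l.
  have card0 : 0 < \sum_(v : G) (1 : R) ^+ 2 by apply: (@sum_sqr_gt0 R G (fun=> 1) w); apply: oner_neq0.
  rewrite -(pmulr_lge0 _ card0); apply: le_trans (xmax (fun=> 1)).
  by apply: sumr_ge0 => v _; rewrite mul1r; apply: sumr_ge0.
have hge1 : (1 : R) <= h%:R by rewrite ler1n.
rewrite hh in htree hpos.
have key K : (D0 + 1)%:R = K -> 2 <= K ->
    lambda_min R (line_graph G) + 2 <= lambda_max R (line_graph G) + 2 - 2 * l + delta_low K ->
    l - lambda_min R G <= lambda_max R (line_graph G) - lambda_min R (line_graph G).
  move=> eK K2 hs; rewrite eK in hlam; have := cos_pi_div_le K2.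
  rewrite -/(delta_low K); move: hs hlam; move: (delta_low K) (cos _) => t c.
  move: (lambda_min R (line_graph G)) (lambda_max R (line_graph G)) (lambda_min R G) => a b d.
  by clear; lra.
have gs : size (cyc o) = g by rewrite (cyc_size o).
have g2 : (2 < g)%N by rewrite -gs cyc_gt2.
have [g3|g3] := eqVneq g 3%N.
  have eK : (D0 + 1)%:R = 3 + h%:R :> R by rewrite -natrD; congr _%:R; rewrite hD0 g3 /=; lia.
  apply: key eK _ _; first by move: hge1; clear; lra.
  rewrite hh; have [h1|h2] := leqP h 1.
    by apply: (triangle_leaves e0 godd x0 hx w0 _ _ htree); rewrite ?gs // -hh; lia.
  rewrite hh in h2; have [k1|k2] := leqP #|kids o w| 1.
    by apply: (triangle_path e0 godd x0 hx l0 w0 htree hpos _ h2 k1); rewrite gs.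
  by apply: (triangle_broom e0 godd x0 hx l0 w0 htree _ h2 k2); rewrite gs.
have [g5|g5] := eqVneq g 5%N.
  have eK : (D0 + 1)%:R = 4 + h%:R :> R by rewrite -natrD; congr _%:R; rewrite hD0 g5 /=; lia.
  apply: key eK _ _; first by move: hge1; clear; lra.
  by rewrite hh; apply: (pentagon_bound e0 godd x0 hx l0 w0 htree hpos); rewrite gs.
have g7 : (6 < g)%N by move: hodd g2 g3 g5; case: (g) => [|[|[|[|[|[|[|]]]]]]].
have eK : (D0 + 1)%:R = (g%:R + 3) / 2 + h%:R :> R.
  have -> : (D0 + 1 = (g + 3) %/ 2 + h)%N by rewrite hD0; lia.
  rewrite natrD; congr (_ + _).
  have e : (g + 3 = (g + 3) %/ 2 * 2)%N by move: hodd; lia.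
  have := congr1 (fun n => n%:R : R) e; rewrite natrM natrD => ->.
  by rewrite mulfK // pnatr_eq0.
have h7 : (7 : R) <= g%:R by rewrite ler_nat.
apply: key eK _ _; first by move: h7 hge1; clear; lra.
by rewrite hh -gs; apply: (long_cycle_bound e0 godd x0 hx l0 w0 htree hpos); rewrite gs.
Qed.
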